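(* Let $1\le p,q\le\infty$ and let $E$ and $F$ be symmetric sequence spaces. If $E$ is $p$-convex and $F$ is $q$-concave, then $\mathcal M(E,F)\subseteq\mathcal M(p,q)$.
   Context: Sequences and matrices have entries in a fixed field $\mathbb K$ ($\mathbb R$ or $\mathbb C$). $c_0$ is the space of sequences converging to zero; for $x\in c_0$, $|x|=(|x_i|)_{i\ge1}$ and $x^*$ is the non-increasing rearrangement of $|x|$. A symmetric sequence space is a linear subspace $E\subset c_0$ with a complete norm such that: (i) if $y\in E$, $x\in c_0$ and $|x|\le|y|$ coordinatewise, then $x\in E$ and $\|x\|\le\|y\|$; (ii) if $x\in E$, $x'\in c_0$ and $(x')^*=x^*$, then $x'\in E$ and $\|x'\|=\|x\|$; normalised so that $\|(1,0,0,\dots)\|=1$. $E$ is $p$-convex ($1\le p\le\infty$) if there is $C>0$ with $\|(\sum_{k=1}^n|x_k|^p)^{1/p}\|_E\le C(\sum_{k=1}^n\|x_k\|_E^p)^{1/p}$ for all finite families $x_1,\dots,x_n\in E$, and $q$-concave ($1\le q\le\infty$) if there is $C>0$ with $(\sum_{k=1}^n\|x_k\|_E^q)^{1/q}\le C\|(\sum_{k=1}^n|x_k|^q)^{1/q}\|_E$ for all such families (operations coordinatewise; maxima replace sums when the exponent is $\infty$). For sequence spaces $X,Y$ (symmetric sequence spaces, or $l_r$ with $1\le r\le\infty$), $B(X,Y)$ is the space of bounded linear operators $X\to Y$, identified with infinite matrices $A=(a_{ij})_{i,j\ge1}$ acting by $A(x)=(\sum_j a_{ij}x_j)_i$. The Schur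 product of matrices is $A*B=(a_{ij}b_{ij})$. $\mathcal M(X,Y)$ is the set of all infinite matrices $M$ with $M*A\in B(X,Y)$ for every $A\in B(X,Y)$, and $\mathcal M(p,q):=\mathcal M(l_p,l_q)$. *)

(* Defs.v *)
From HB Require Import structures.
From mathcomp Require Import all_boot all_order all_algebra.
From mathcomp Require Import all_classical all_reals all_analysis.
From mathcomp Require Import complex.

Set Implicit Arguments.
Unset Strict Implicit.
Unset Printing Implicit Defensive.

Import Order.TTheory GRing.Theory Num.Theory.
Import numFieldNormedType.Exports.

Local Open Scope classical_set_scope.
Local Open Scope ring_scope.

(** Sequences are indexed from 0 instead of 1 throughout. *)

Variant scalar_kind := RealScalars | ComplexScalars.

Definition scalars (R : realType) (k : scalar_kind) : numFieldType :=
  match k with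
  | RealScalars => R
  | ComplexScalars => R[i]
  end.

(* The library norm of [R[i]] takes its values in [R[i]], so the real-valued
   modulus has to be named separately. *)
Definition modulus (R : realType) (k : scalar_kind) : scalars R k -> R :=
  match k return scalars R k -> R with
  | RealScalars => fun x : R => `|x|
  | ComplexScalars => fun z : R[i] => Normc.normc z
  end.

Definition of_real (R : realType) (k : scalar_kind) : R -> scalars R k :=
  match k return R -> scalars R k with
  | RealScalars => fun x => x
  | ComplexScalars => fun x => x%:C%C
  end.

Arguments of_real {R} k x.

Section Definitions.
Context {R : realType} {k : scalar_kind}.
Local Notation K := (scalars R k).
Implicit Types (x y : nat -> K) (p q : \bar R).

Definition c0 : set (nat -> K) := [set x | x @ \oo --> (0 : K)].

(* [x^*_n = inf {t >= 0 : at most n indices i satisfy |x_i| > t}], the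
   generalised inverse of the distribution function of [|x|]: for [x] in [c0]
   this lists the values of [|x|] in non-increasing order with multiplicity
   (omitting zeros if infinitely many values are nonzero). *)
Definition rearrangement x : nat -> R := fun n =>
  inf [set t : R | 0 <= t /\ ([set i | t < modulus (x i)] #<= `I_n)%card].

(* The norm is a total function; only its values on the carrier matter. *)
Record seq_space := SeqSpace {
  carrier : set (nat -> K) ;
  seq_norm : (nat -> K) -> R }.

Record symmetric_seq_space (E : seq_space) : Prop := {
  sym_c0 : carrier E `<=` c0 ;
  sym_zero : carrier E (fun=> 0) ;
  sym_add : forall x y, carrier E x -> carrier E y -> carrier E (fun i => x i + y i) ;
  sym_scale : forall (a : K) x, carrier E x -> carrier E (fun i => a * x i) ;
  sym_norm_triangle : forall x y, carrier E x -> carrier E y ->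
    seq_norm E (fun i => x i + y i) <= seq_norm E x + seq_norm E y ;
  sym_norm_scale : forall (a : K) x, carrier E x ->
    seq_norm E (fun i => a * x i) = modulus a * seq_norm E x ;
  sym_norm_definite : forall x, carrier E x -> seq_norm E x = 0 -> x = (fun=> 0) ;
  sym_complete : forall u : nat -> (nat -> K), (forall n, carrier E (u n)) ->
    (forall e : R, 0 < e -> exists N, forall m n, (N <= m)%N -> (N <= n)%N ->
       seq_norm E (fun i => u m i - u n i) < e) ->
    exists2 x, carrier E x &
      (fun n => seq_norm E (fun i => u n i - x i)) @ \oo --> (0 : R) ;
  sym_solid : forall x y, carrier E y -> c0 x ->
    (forall i, modulus (x i) <= modulus (y i)) ->
    carrier E x /\ seq_norm E x <= seq_norm E y ;
  sym_rearrangement : forall x x', carrier E x -> c0 x' ->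
    rearrangement x' = rearrangement x ->
    carrier E x' /\ seq_norm E x' = seq_norm E x ;
  sym_normalised : carrier E (fun i => (i == 0%N)%:R) /\
    seq_norm E (fun i => (i == 0%N)%:R) = 1 }.

(* [(\sum_j (a j)^p)^(1/p)], or the maximum if [p = +oo], for nonnegative [a]. *)
Definition fin_lnorm p (n : nat) (a : 'I_n -> R) : R :=
  match p with
  | r%:E => (\sum_j a j `^ r) `^ r^-1
  | _ => \big[Num.max/0]_j a j
  end.

Definition lattice_lnorm p (n : nat) (x : 'I_n -> nat -> K) : nat -> K :=
  fun i => of_real k (fin_lnorm p (fun j => modulus (x j i))).

Definition p_convex p (E : seq_space) : Prop :=
  exists2 C : R, 0 < C & forall (n : nat) (x : 'I_n -> nat -> K),
    (forall j, carrier E (x j)) ->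
    seq_norm E (lattice_lnorm p x) <= C * fin_lnorm p (fun j => seq_norm E (x j)).

Definition q_concave q (E : seq_space) : Prop :=
  exists2 C : R, 0 < C & forall (n : nat) (x : 'I_n -> nat -> K),
    (forall j, carrier E (x j)) ->
    fin_lnorm q (fun j => seq_norm E (x j)) <= C * seq_norm E (lattice_lnorm q x).

(* The extended norm of [l_p] is the [L^p] norm of the counting measure. *)
Definition lp_enorm p x : \bar R :=
  Lnorm counting p (fun i => (modulus (x i))%:E).

Definition lp p : seq_space :=
  SeqSpace [set x | (lp_enorm p x < +oo)%E] (fun x => fine (lp_enorm p x)).

Definition inf_matrix := nat -> nat -> K.

(* Each row series [\sum_j a_ij x_j] is required to converge in [K]. *)
Definition bounded_matrices (X Y : seq_space) : set inf_matrix :=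
  [set A | exists C : R, forall x, carrier X x -> exists y,
     [/\ carrier Y y,
         forall i, series (fun j => A i j * x j) @ \oo --> y i &
         seq_norm Y y <= C * seq_norm X x]].

Definition schur_product (A B : inf_matrix) : inf_matrix :=
  fun i j => A i j * B i j.

Definition schur_multipliers (X Y : seq_space) : set inf_matrix :=
  [set M | forall A, bounded_matrices X Y A ->
     bounded_matrices X Y (schur_product M A)].

End Definitions.

Arguments seq_space : clear implicits.
Arguments inf_matrix : clear implicits.

(* Main.v *)
Require Import Defs.
From mathcomp Require Import all_boot all_order all_algebra.
From mathcomp Require Import all_classical all_reals all_analysis.
From mathcomp Require Import complex ring lra.

(** The exponents enter through factorizations of finite sequences.

    If [E] is [p]-convex, every finitely supported [x] can be written as a
    coordinatewise product [a * e], where [e] has norm at most [C * ||x||_p] in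
    [E] and [z |-> a * z] maps [E] to l_p with norm at most [C]
    ([p_convex_factorization]). Dually, if [F] is [q]-concave, every finite
    sequence [y] admits some [b] such that [v |-> b * v] maps l_q to [F] with norm
    at most [C] and [||y||_q <= C * ||b * y||_F] ([q_concave_factorization]).

    Both are Lozanovskii-type factorizations, obtained by maximising an entropy
    [\sum_i c i * ln (w i)] with weights [c i] proportional to [|x i|^p], or to
    [|y i|^q]. On the convex side, [w] runs over the sums [\sum_j |z_j|^p] of
    families of given [\sum_j ||z_j||^p]: adding a small multiple of [z] to an
    optimal family shows that [\sum_i c i * |z i|^p / w i <= ||z||^p], and
    convexity bounds the norm of [w^(1/p)]. On the concave side, [w] is
    normalised by the superadditive envelope
    [sup { \sum_j ||z_j||^q : \sum_j |z_j|^q = w }]; removing a small multiple of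
    [|z|^q] from an optimal [w] gives the reverse inequality
    [||z||^q <= \sum_i c i * |z i|^q / w i]. Near-optimal [w] suffice, at the price
    of a constant.

    Now let [M] be a multiplier of [B(E, F)] and [A] an operator from l_p to l_q.
    For each pair [a], [b] as above, the matrix [b i * A i j * a j] belongs to
    [B(E, F)], hence so does [b i * (M * A) i j * a j], and if the bounds were
    uniform in [a] and [b] the two factorizations would bound [M * A] on finite
    sequences. Uniformity comes from positivity: a sequence of pairs
    [a_m], [b_m] violating it is dominated, up to factors [2^-(m+1)], by the single
    pair [a = \sum_m 2^-(m+1) a_m], [b = \sum_m 2^-(m+1) b_m], and solidity of the
    spaces transfers the one bound obtained for [a] and [b] to all of them
    ([multiplier_sections_bounded]). Finally, uniform bounds on finite sections
    give absolutely convergent rows, hence a bounded operator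
    ([bounded_matrices_of_sections]). *)

Set Implicit Arguments.
Unset Strict Implicit.
Unset Printing Implicit Defensive.

Import Order.TTheory GRing.Theory Num.Theory.
Import numFieldNormedType.Exports.

Local Open Scope classical_set_scope.
Local Open Scope ring_scope.

(** * Real and complex scalars *)

Section Scalars.
Context {R : realType} {k : scalar_kind}.
Local Notation K := (scalars R k).

Lemma modulus_ge0 (x : K) : 0 <= modulus x.
Proof. by case: k x => [x|[a b]] /=; rewrite ?normr_ge0 ?sqrtr_ge0. Qed.

Lemma modulusM (x y : K) : modulus (x * y) = modulus x * modulus y.
Proof. by case: k x y => x y /=; [exact: normrM | exact: Normc.normcM]. Qed.

Lemma ler_modulusD (x y : K) : modulus (x + y) <= modulus x + modulus y.
Proof. by case: k x y => x y /=; [exact: ler_normD | exact: le_normcD]. Qed.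

Lemma modulusN (x : K) : modulus (- x) = modulus x.
Proof. by case: k x => x /=; [exact: normrN | exact: normcN]. Qed.

Lemma modulus0 : modulus (0 : K) = 0.
Proof. by case: k; [exact: normr0 | exact: Normc.normc0]. Qed.

Lemma modulus1 : modulus (1 : K) = 1.
Proof. by case: k; [exact: normr1 | exact: Normc.normc1]. Qed.

Lemma modulus_eq0 (x : K) : (modulus x == 0) = (x == 0).
Proof.
apply/idP/eqP => [|->]; last by rewrite modulus0.
by case: k x => x /= /eqP; [exact: normr0_eq0 | exact: Normc.eq0_normc].
Qed.

Lemma modulus_of_real (r : R) : modulus (of_real k r) = `|r|.
Proof. by case: k => //=; rewrite expr0n /= addr0 sqrtr_sqr. Qed.

Lemma of_realM (r s : R) : of_real k (r * s) = of_real k r * of_real k s.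
Proof. by case: k => //=; rewrite rmorphM. Qed.

Lemma of_realD (r s : R) : of_real k (r + s) = of_real k r + of_real k s.
Proof. by case: k => //=; rewrite rmorphD. Qed.

Lemma of_real0 : of_real k (0 : R) = 0.
Proof. by case: k. Qed.

Lemma of_real1 : of_real k (1 : R) = 1.
Proof. by case: k. Qed.

Lemma norm_modulus (x : K) : `|x| = of_real k (modulus x).
Proof. by case: k x. Qed.

Lemma ltr_of_real (r s : R) : (of_real k r < of_real k s) = (r < s).
Proof. by case: k => //=; rewrite ltcR. Qed.

(** The topology of the complex scalars is defined by a norm with complex
    values; this restates convergence with real radii for both scalar kinds. *)
Lemma cvg_modulusP (u : nat -> K) (l : K) :
  u @ \oo --> l <->
  forall e : R, 0 < e -> \forall n \near \oo, modulus (l - u n) < e.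
Proof.
rewrite (@cvgrPdist_lt K); split=> H e e0.
  have: 0 < of_real k e by rewrite -of_real0 ltr_of_real.
  by move=> /H; apply: filterS => n; rewrite norm_modulus ltr_of_real.
have eE : e = of_real k (modulus e) by rewrite -norm_modulus gtr0_norm.
rewrite eE -of_real0 ltr_of_real in e0; rewrite eE.
by apply: filterS (H _ e0) => n; rewrite norm_modulus ltr_of_real.
Qed.

Lemma cvg_modulus_uniq (u : nat -> K) (l l' : K) :
  u @ \oo --> l -> u @ \oo --> l' -> l = l'.
Proof. by move=> H1 H2; apply: (@cvg_unique K _ (u @ \oo)). Qed.

Lemma phase_decomposition (x : K) :
  exists2 z : K, modulus z = 1 & x = z * of_real k (modulus x).
Proof.
have [->|x0] := eqVneq x 0.
  by exists 1; rewrite ?modulus1 // modulus0 of_real0 mulr0.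
have m0 : modulus x != 0 by rewrite modulus_eq0.
exists (x * of_real k (modulus x)^-1).
  by rewrite modulusM modulus_of_real gtr0_norm ?divff // invr_gt0 lt0r m0 modulus_ge0.
by rewrite -mulrA -of_realM mulVf // of_real1 mulr1.
Qed.

End Scalars.

Lemma abs_bounded_series_cvg_real (R : realType) (u : nat -> R) (B : R) :
  (forall n, \sum_(j < n) `|u j| <= B) -> cvgn (series u).
Proof.
move=> H; apply: normed_cvg; apply: nondecreasing_is_cvgn.
  by apply: nondecreasing_series => i _ _; exact: normr_ge0.
by exists B => _ [n _ <-] /=; rewrite /series /= big_mkord.
Qed.

(** Absolutely convergent scalar series converge; in the complex case, by
    completeness of the reals applied to real and imaginary parts. *)
Lemma abs_bounded_series_cvg (R : realType) (k : scalar_kind)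
    (u : nat -> scalars R k) (B : R) :
  (forall n, \sum_(j < n) modulus (u j) <= B) ->
  exists l : scalars R k, series u @ \oo --> l.
Proof.
case: k u => /= u H.
  by move: (abs_bounded_series_cvg_real H) => H1; exists (lim (series u @ \oo)).
have abs_re n : `|complex.Re (u n)| <= Normc.normc (u n).
  case: (u n) => a b /=; rewrite -sqrtr_sqr ler_wsqrtr // lerDl; exact: sqr_ge0.
have abs_im n : `|complex.Im (u n)| <= Normc.normc (u n).
  case: (u n) => a b /=; rewrite -sqrtr_sqr ler_wsqrtr // lerDr; exact: sqr_ge0.
have re_cvg : cvgn (series (fun n => complex.Re (u n))).
  apply: (@abs_bounded_series_cvg_real _ _ B) => n.
  by apply: le_trans (H n); apply: ler_sum.
have im_cvg : cvgn (series (fun n => complex.Im (u n))).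
  apply: (@abs_bounded_series_cvg_real _ _ B) => n.
  by apply: le_trans (H n); apply: ler_sum.
set a := lim (series (fun n => complex.Re (u n)) @ \oo) in re_cvg.
set b := lim (series (fun n => complex.Im (u n)) @ \oo) in im_cvg.
exists (a +i* b)%C; apply/(@cvg_modulusP R ComplexScalars) => e e0.
have series_ReIm m : series u m = (series (fun n => complex.Re (u n)) m +i*
    series (fun n => complex.Im (u n)) m)%C.
  rewrite /series /=; elim: m => [|m IH]; first by rewrite !big_geq.
  by rewrite !big_nat_recr //= IH; case: (u m).
have sqrt_le (s t : R) : Num.sqrt (s ^+ 2 + t ^+ 2) <= `|s| + `|t|.
  rewrite -[leRHS]ger0_norm ?addr_ge0 // -sqrtr_sqr ler_wsqrtr //.
  rewrite sqrrD !real_normK ?num_real // -subr_ge0.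
  have -> : s ^+ 2 + `|s| * `|t| *+ 2 + t ^+ 2 - (s ^+ 2 + t ^+ 2) =
     `|s| * `|t| *+ 2 by ring.
  by rewrite mulrn_wge0 // mulr_ge0.
have e20 : 0 < e / 2 by rewrite divr_gt0.
move/cvgrPdist_lt: re_cvg => /(_ _ e20) re_near.
move/cvgrPdist_lt: im_cvg => /(_ _ e20) im_near.
near=> n.
have Hre : `|a - series (fun n => complex.Re (u n)) n| < e / 2.
  by near: n; exact: re_near.
have Him : `|b - series (fun n => complex.Im (u n)) n| < e / 2.
  by near: n; exact: im_near.
rewrite series_ReIm.
rewrite /= in Hre Him *.
set s := (_ - _) in Hre *; set t := (_ - _) in Him *.
have st := sqrt_le s t.
lra.
Unshelve. all: by end_near.
Qed.

(** * Finite sections of l_p norms *)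

Section FinLnorm.
Context {R : realType}.
Implicit Types (p : \bar R) (n : nat) (r : R).

Lemma fin_lnorm_ge0 p n (a : 'I_n -> R) : 0 <= fin_lnorm p a.
Proof.
by case: p => [r| |] /=; rewrite ?powR_ge0 //; exact: bigmax_ge_id.
Qed.

Lemma powR_invK r (a : R) : 0 < r -> 0 <= a -> (a `^ r^-1) `^ r = a.
Proof. by move=> r0 a0; rewrite -powRrM mulVf ?gt_eqF // powRr1. Qed.

Lemma powRK_inv r (a : R) : 0 < r -> 0 <= a -> (a `^ r) `^ r^-1 = a.
Proof. by move=> r0 a0; rewrite -powRrM mulfV ?gt_eqF // powRr1. Qed.

Lemma ler_powR_pos r (a b : R) : 0 < r -> 0 <= a -> 0 <= b ->
  (a `^ r <= b `^ r) = (a <= b).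
Proof.
move=> r0 a0 b0; apply/idP/idP => [H|]; last first.
  by move=> H; apply: ge0_ler_powR => //; exact: ltW.
have ri0 : 0 <= r^-1 by rewrite invr_ge0 ltW.
by move: (ge0_ler_powR ri0 (powR_ge0 a r) (powR_ge0 b r) H); rewrite !powRK_inv.
Qed.

Lemma fin_lnorm_powR r n (a : 'I_n -> R) : 0 < r ->
  fin_lnorm r%:E a `^ r = \sum_j a j `^ r.
Proof.
by move=> r0 /=; rewrite powR_invK // sumr_ge0 // => j _; exact: powR_ge0.
Qed.

Lemma fin_lnorm_leP r n (a : 'I_n -> R) (L : R) : 0 < r -> 0 <= L ->
  (fin_lnorm r%:E a <= L) = (\sum_j a j `^ r <= L `^ r).
Proof.
by move=> r0 L0; rewrite -fin_lnorm_powR // ler_powR_pos // fin_lnorm_ge0.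
Qed.

Variant exponent_spec : \bar R -> Prop :=
  | FiniteExponent r of 1 <= r : exponent_spec r%:E
  | InfiniteExponent : exponent_spec +oo%E.

Lemma exponentP p : (1 <= p)%E -> exponent_spec p.
Proof.
case: p => [r||] p1; [exact: FiniteExponent | exact: InfiniteExponent |].
by rewrite leeNy_eq in p1.
Qed.

Lemma ler_fin_lnorm p n (a b : 'I_n -> R) : (1 <= p)%E ->
  (forall j, 0 <= a j <= b j) -> fin_lnorm p a <= fin_lnorm p b.
Proof.
move=> /exponentP[r r1|] ab; last first.
  by apply: le_bigmax2 => j _; case/andP: (ab j).
have r0 : 0 < r by rewrite (lt_le_trans ltr01).
rewrite fin_lnorm_leP ?fin_lnorm_ge0 // fin_lnorm_powR //; apply: ler_sum => j _.
by case/andP: (ab j) => a0 aleb; rewrite ler_powR_pos // (le_trans a0).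
Qed.

Lemma eq_fin_lnorm p n (a b : 'I_n -> R) : a =1 b -> fin_lnorm p a = fin_lnorm p b.
Proof. by move=> ab; congr fin_lnorm; exact/funext. Qed.

Lemma ler_coord_fin_lnorm p n (a : 'I_n -> R) j : (1 <= p)%E ->
  (forall j, 0 <= a j) -> a j <= fin_lnorm p a.
Proof.
move=> /exponentP[r r1|] a0; last by apply: le_bigmax.
have r0 : 0 < r by rewrite (lt_le_trans ltr01).
rewrite -(ler_powR_pos r0) ?fin_lnorm_ge0 // fin_lnorm_powR //.
by rewrite (bigD1 j) //= lerDl sumr_ge0 // => i _; exact: powR_ge0.
Qed.

Lemma fin_lnormZ p n (a : 'I_n -> R) (t : R) : (1 <= p)%E -> 0 <= t ->
  (forall j, 0 <= a j) -> fin_lnorm p (fun j => t * a j) = t * fin_lnorm p a.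
Proof.
move=> /exponentP[r r1|] t0 a0; last first.
  rewrite /=; elim/big_ind2 : _ => [|x x' y y' -> ->|//]; first by rewrite mulr0.
  by rewrite maxr_pMr.
have r0 : 0 < r by rewrite (lt_le_trans ltr01).
rewrite /=; under eq_bigr do rewrite powRM //.
rewrite -mulr_sumr powRM ?powR_ge0 ?powRK_inv //.
by rewrite sumr_ge0 // => j _; exact: powR_ge0.
Qed.

(** Membership of a nonnegative sequence in the ball of radius [L] of l_p,
    expressed through finite sections so that no infinite sum is involved. *)
Definition lnorm_le p (f : nat -> R) (L : R) :=
  forall n, fin_lnorm p (fun j : 'I_n => f j) <= L.

Lemma lnorm_le_ge0 p f (L : R) : lnorm_le p f L -> 0 <= L.
Proof. by move=> /(_ 0%N); apply: le_trans; exact: fin_lnorm_ge0. Qed.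

(** The essential supremum for the counting measure is the supremum, because
    every point has positive mass. *)
Lemma counting_ae (P : nat -> Prop) :
  (\forall i \ae (@counting nat R), P i) -> forall i, P i.
Proof.
move=> [N [_ + PN]] i; apply: contraPP => nPi; have Ni := PN i nPi.
rewrite /counting; case: asboolP => // finN [] /eqP.
rewrite pnatr_eq0 finmap.cardfs_eq0 => /eqP N0.
by have := in_fset_set finN i; rewrite N0 finmap.in_fset0 mem_set.
Qed.

Lemma lnorm_leP p f (L : R) : (1 <= p)%E -> (forall j, 0 <= f j) ->
  lnorm_le p f L <-> (Lnorm counting p (EFin \o f) <= L%:E)%E.
Proof.
move=> /exponentP[r r1|] f0.
  have r0 : 0 < r by rewrite (lt_le_trans ltr01).
  rewrite Lnorm_counting //.
  have sum_ge0 : (0 <= \sum_(k <oo) (`|(EFin \o f) k| `^ r))%E.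
    by apply: nneseries_ge0 => n _ _; exact: poweR_ge0.
  have sumE n : (\sum_(0 <= k < n) (`|(EFin \o f) k| `^ r))%E =
      (\sum_(j < n) f j `^ r)%:E.
    rewrite big_mkord -sumEFin; apply: eq_bigr => j _ /=.
    by rewrite ger0_norm // poweR_EFin.
  split=> H.
    have L0 := lnorm_le_ge0 H.
    have le_pow : (\sum_(k <oo) (`|(EFin \o f) k| `^ r) <= (L `^ r)%:E)%E.
      apply: lime_le; first by apply: is_cvg_nneseries => n _ _; exact: poweR_ge0.
      by apply: nearW => n; rewrite sumE lee_fin -fin_lnorm_leP.
    rewrite -(powRK_inv r0 L0) -poweR_EFin.
    apply: gt0_ler_poweR => //; first by rewrite invr_ge0 ltW.
    - by rewrite in_itv /= sum_ge0 leey.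
    - by rewrite in_itv /= lee_fin powR_ge0 leey.
  have L0 : 0 <= L by rewrite -lee_fin (le_trans _ H) ?poweR_ge0.
  move=> n; rewrite fin_lnorm_leP // -lee_fin -sumE.
  apply: (@le_trans _ _ (\sum_(k <oo) (`|(EFin \o f) k| `^ r))%E).
    by apply: nneseries_lim_ge => k _ _; exact: poweR_ge0.
  rewrite -poweR_EFin -[leLHS](poweRe1 sum_ge0) -(mulVf (lt0r_neq0 r0)) poweRrM.
  apply: gt0_ler_poweR => //; first exact: ltW.
  - by rewrite in_itv /= poweR_ge0 leey.
  - by rewrite in_itv /= lee_fin L0 leey.
have mu_gt0 : (0 < (@counting nat R) [set: nat])%E.
  by rewrite /counting asboolF ?ltry //; exact: infinite_nat.
rewrite unlock mu_gt0; split=> H.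
  apply/ess_sup_inf.ess_supP/nearW => n /=; rewrite ger0_norm // lee_fin.
  apply: le_trans (H n.+1).
  exact: (@ler_coord_fin_lnorm +oo%E n.+1 (fun j => f j) ord_max (leey _)).
move/ess_sup_inf.ess_supP/counting_ae : H => H.
have {}H n : f n <= L by have := H n; rewrite /= ger0_norm // lee_fin.
by move=> n; apply: bigmax_le => [|i _]; rewrite ?H // (le_trans (f0 0%N)).
Qed.

(** Minkowski's inequality, transported from the counting measure. *)
Lemma lnorm_leD p f g (L M : R) : (1 <= p)%E ->
  (forall j, 0 <= f j) -> (forall j, 0 <= g j) ->
  lnorm_le p f L -> lnorm_le p g M -> lnorm_le p (fun j => f j + g j) (L + M).
Proof.
move=> p1 f0 g0 /lnorm_leP-/(_ p1 f0) Hf /lnorm_leP-/(_ p1 g0) Hg.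
apply/lnorm_leP => //; first by move=> j; rewrite addr_ge0.
by rewrite EFinD (le_trans _ (leeD Hf Hg)) //; exact: eminkowski.
Qed.

Lemma lnorm_leZ p f (t L : R) : (1 <= p)%E -> 0 <= t -> (forall j, 0 <= f j) ->
  lnorm_le p f L -> lnorm_le p (fun j => t * f j) (t * L).
Proof.
by move=> p1 t0 f0 Hf n; rewrite fin_lnormZ // ler_wpM2l.
Qed.

(** Balls are closed under coordinatewise limits: shrinking the limit by a
    factor [t < 1] puts it eventually below the approximants, so monotonicity
    and homogeneity suffice. *)
Lemma fin_lnorm_lim p n (a : nat -> 'I_n -> R) (b : 'I_n -> R) (L : R) :
  (1 <= p)%E -> (forall m j, 0 <= a m j) -> (forall j, 0 <= b j) ->
  (forall j, a ^~ j @ \oo --> b j) ->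
  (forall m, fin_lnorm p (a m) <= L) -> fin_lnorm p b <= L.
Proof.
move=> p1 a0 b0 ab aL.
have L0 : 0 <= L by apply: le_trans (aL 0%N); exact: fin_lnorm_ge0.
have key (t : R) : 0 < t < 1 -> t * fin_lnorm p b <= L.
  case/andP => t0 t1.
  have near_le j : \forall m \near \oo, t * b j <= a m j.
    have [bj0|bj0] := eqVneq (b j) 0.
      by apply: nearW => m; rewrite bj0 mulr0.
    have bj_gt0 : 0 < b j by rewrite lt0r bj0 b0.
    have e0 : 0 < (1 - t) * b j by rewrite mulr_gt0 // subr_gt0.
    move/cvgrPdist_le: (ab j) => /(_ _ e0); apply: filterS => m.
    by move=> /(le_trans (ler_norm _)); lra.
  have [m _ Hm] : \forall m \near \oo, forall j, t * b j <= a m j.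
    by apply: filter_forall => j; exact: near_le.
  rewrite -fin_lnormZ ?(ltW t0) //; apply: le_trans (aL m).
  by apply: ler_fin_lnorm => // j; rewrite (mulr_ge0 (ltW t0)) //=; exact: (Hm m (leqnn m)).
rewrite leNgt; apply/negP => Lb.
have b_gt0 : 0 < fin_lnorm p b by apply: le_lt_trans Lb.
pose t := (L + fin_lnorm p b) / (2 * fin_lnorm p b).
have tb : t * fin_lnorm p b = (L + fin_lnorm p b) / 2.
  by rewrite /t; field; rewrite gt_eqF.
have t01 : 0 < t < 1.
  by rewrite /t divr_gt0 ?ltr_wpDl ?mulr_gt0 //= ltr_pdivrMr ?mulr_gt0 //; lra.
have := key t t01; rewrite tb; lra.
Qed.

End FinLnorm.

Section LpSpace.
Context {R : realType} {k : scalar_kind}.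
Local Notation K := (scalars R k).
Implicit Types (p : \bar R) (x : nat -> K).

Lemma lp_enorm_leP p x (L : R) : (1 <= p)%E ->
  lnorm_le p (fun i => modulus (x i)) L <-> (lp_enorm p x <= L%:E)%E.
Proof.
by move=> p1; apply: iff_trans (lnorm_leP L p1 (fun j => modulus_ge0 (x j))) _.
Qed.

Lemma carrier_lp p x (L : R) : (1 <= p)%E ->
  lnorm_le p (fun i => modulus (x i)) L ->
  carrier (lp p) x /\ seq_norm (lp p) x <= L.
Proof.
move=> p1 /lp_enorm_leP-/(_ p1) H; split=> /=.
  by apply: le_lt_trans H _; exact: ltry.
rewrite -lee_fin fineK // ge0_fin_numE ?Lnorm_ge0 //.
by apply: le_lt_trans H _; exact: ltry.
Qed.

Lemma carrier_lp_le p x : (1 <= p)%E -> carrier (lp p) x ->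
  lnorm_le p (fun i => modulus (x i)) (seq_norm (lp p) x).
Proof.
move=> p1 /= xfin; apply/lp_enorm_leP => //.
by rewrite fineK // ge0_fin_numE ?Lnorm_ge0.
Qed.

End LpSpace.

(** * Finitely supported sequences in symmetric spaces *)

Section SymmetricSpace.
Context {R : realType} {k : scalar_kind}.
Local Notation K := (scalars R k).
Implicit Types (x y : nat -> K) (n : nat).

Definition finsupp n x := forall i, (n <= i)%N -> x i = 0.

Definition trunc n x : nat -> K := fun i => if (i < n)%N then x i else 0.

Lemma finsupp_trunc n x : finsupp n (trunc n x).
Proof. by move=> i ni; rewrite /trunc ltnNge ni. Qed.

Lemma c0_finsupp n x : finsupp n x -> c0 x.
Proof.
move=> xn; apply/cvg_modulusP => e e0; exists n => // m /= nm.
by rewrite xn // subrr modulus0.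
Qed.

Definition unit_seq (j : nat) : nat -> K := fun i => (i == j)%:R.

(** Each level set of a unit vector is a singleton or empty, wherever the
    nonzero entry sits; rearrangement invariance then puts all unit vectors
    in the space, with norm one. *)
Lemma rearrangement_unit_seq j : rearrangement (unit_seq j) = rearrangement (unit_seq 0).
Proof.
apply/funext => n; rewrite /rearrangement; congr inf; apply/seteqP.
have level i (t : R) : 0 <= t ->
    [set l | t < modulus (unit_seq i l)] = if t < 1 then [set i] else set0.
  move=> t0; apply/seteqP; split=> l; rewrite /unit_seq /=.
    have [->|] := eqVneq l i; first by rewrite modulus1 => ->.
    by rewrite modulus0 ltNge t0.
  by case: ifP => // t1 /= ->; rewrite eqxx modulus1.
have card_level i i' (t : R) : 0 <= t ->
    ([set l | t < modulus (unit_seq i l)] #<= `I_n)%card ->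
    ([set l | t < modulus (unit_seq i' l)] #<= `I_n)%card.
  move=> t0; rewrite !level //; case: ifP => // t1.
  apply: card_le_trans.
  by rewrite -(image_set1 (fun=> i') i); exact: card_image_le.
by split=> t [t0 /card_level H]; split=> //; exact: H.
Qed.

Variable E : seq_space R k.
Hypothesis hE : symmetric_seq_space E.

Lemma sym_norm_ext x y : x =1 y -> seq_norm E x = seq_norm E y.
Proof. by move=> xy; congr seq_norm; exact/funext. Qed.

Lemma carrier_ext x y : x =1 y -> carrier E x -> carrier E y.
Proof. by move=> /funext ->. Qed.

Lemma carrier_unit_seq j : carrier E (unit_seq j) /\ seq_norm E (unit_seq j) = 1.
Proof.
have [E0 N0] := sym_normalised hE.
have c0j : c0 (unit_seq j).
  apply: (@c0_finsupp j.+1) => i ji; rewrite /unit_seq.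
  by rewrite (gtn_eqF ji).
have [] := sym_rearrangement hE E0 c0j (rearrangement_unit_seq j).
by move=> ? ->.
Qed.

Lemma sym_norm0 : seq_norm E (fun=> 0) = 0.
Proof.
have := sym_norm_scale hE 0 (sym_zero hE); rewrite modulus0 [RHS]mul0r => N0.
by rewrite -[RHS]N0; apply: sym_norm_ext => i; rewrite mul0r.
Qed.

Lemma sym_norm_ge0 x : carrier E x -> 0 <= seq_norm E x.
Proof.
move=> Ex; have EN := sym_scale hE (-1) Ex.
have := sym_norm_triangle hE Ex EN.
rewrite (sym_norm_scale hE (-1) Ex) modulusN modulus1 mul1r.
have -> : seq_norm E (fun i => x i + -1 * x i) = 0.
  by rewrite -sym_norm0; apply: sym_norm_ext => i; rewrite mulN1r subrr.
lra.
Qed.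

Lemma carrier_sum (I : Type) (s : seq I) (f : I -> nat -> K) :
  (forall i, carrier E (f i)) ->
  carrier E (fun l => \sum_(i <- s) f i l) /\
  seq_norm E (fun l => \sum_(i <- s) f i l) <= \sum_(i <- s) seq_norm E (f i).
Proof.
move=> Ef; elim: s => [|i s [IH1 IH2]].
  have f0 : (fun l => \sum_(i <- [::]) f i l) = (fun=> 0).
    by apply/funext => l; rewrite big_nil.
  by rewrite f0 big_nil sym_norm0; split=> //; exact: sym_zero.
have fD : (fun l => \sum_(j <- i :: s) f j l) =
    (fun l => f i l + \sum_(j <- s) f j l).
  by apply/funext => l; rewrite big_cons.
rewrite fD big_cons; split; first exact: sym_add.
by apply: le_trans (sym_norm_triangle hE (Ef i) IH1) _; rewrite lerD2l.
Qed.

Lemma carrier_finsupp n x : finsupp n x -> carrier E x.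
Proof.
move=> xn.
have [+ _] := @carrier_sum _ (index_enum 'I_n)
  (fun j l => x j * unit_seq j l)
  (fun j => sym_scale hE (x j) (carrier_unit_seq j).1).
apply: carrier_ext => l; rewrite /unit_seq.
have [nl|ln] := leqP n l.
  rewrite xn // big1 // => j _.
  by rewrite gtn_eqF ?mulr0 // (leq_trans (ltn_ord j)).
rewrite (bigD1 (Ordinal ln)) //= eqxx mulr1 big1 ?addr0 // => j.
by rewrite -val_eqE /= eq_sym => /negbTE ->; rewrite mulr0.
Qed.

Lemma sym_mono x y : carrier E x -> carrier E y ->
  (forall i, modulus (x i) <= modulus (y i)) -> seq_norm E x <= seq_norm E y.
Proof. by move=> Ex Ey xy; have [] := sym_solid hE Ey (sym_c0 hE Ex) xy. Qed.

Lemma sym_norm_modulus x y : carrier E x -> carrier E y ->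
  (forall i, modulus (x i) = modulus (y i)) -> seq_norm E x = seq_norm E y.
Proof.
by move=> Ex Ey xy; apply/eqP; rewrite eq_le !sym_mono // => i; rewrite xy.
Qed.

Lemma carrier_sub x y : carrier E x -> carrier E y -> carrier E (fun i => x i - y i).
Proof.
move=> Ex Ey; apply: carrier_ext (sym_add hE Ex (sym_scale hE (-1) Ey)) => i.
by rewrite mulN1r.
Qed.

Lemma sym_norm_subC x y : carrier E x -> carrier E y ->
  seq_norm E (fun i => x i - y i) = seq_norm E (fun i => y i - x i).
Proof.
move=> Ex Ey; apply: sym_norm_modulus; [exact: carrier_sub..|].
by move=> i; rewrite -modulusN opprB.
Qed.

Lemma ler_coord_sym_norm x i : carrier E x -> modulus (x i) <= seq_norm E x.
Proof.
move=> Ex; have [Ei Ni] := carrier_unit_seq i.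
rewrite -[leLHS]mulr1 -Ni -(sym_norm_scale hE _ Ei).
apply: sym_mono => //; first exact: sym_scale.
move=> j; rewrite modulusM /unit_seq; have [->|_] := eqVneq j i.
  by rewrite modulus1 mulr1.
by rewrite modulus0 mulr0 modulus_ge0.
Qed.

End SymmetricSpace.

(** * First order conditions for weighted logarithms *)

Section LogarithmicVariation.
Context {R : realType}.

Lemma ln_lower_bound (s : R) : - 2^-1 <= s -> s - 2 * s ^+ 2 <= ln (1 + s).
Proof.
move=> s2; have s1 : 0 < 1 + s by lra.
have -> : ln (1 + s) = - ln (1 + - (s / (1 + s))).
  rewrite -lnV ?posrE; last first.
    have -> : 1 - s / (1 + s) = (1 + s)^-1 by field; rewrite gt_eqF.
    by rewrite invr_gt0.
  by congr ln; field; rewrite gt_eqF //=; lra.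
have lt1 : -1 < - (s / (1 + s)) by rewrite ltrN2 ltr_pdivrMr //; lra.
rewrite lerNr; apply: le_trans (le_ln1Dx lt1) _.
rewrite lerN2 -subr_ge0.
have -> : s / (1 + s) - (s - 2 * s ^+ 2) = s ^+ 2 * (1 + 2 * s) / (1 + s).
  by field; rewrite gt_eqF.
rewrite (divr_ge0 _ (ltW s1)) // mulr_ge0 ?sqr_ge0 //; lra.
Qed.

(** The domains of the entropy functionals below are not compact; their suprema
    are approached up to [e]. *)
Lemma near_maximum (T : Type) (D : T -> Prop) (f : T -> R) (B e : R) (x0 : T) :
  D x0 -> (forall x, D x -> f x <= B) -> 0 < e ->
  exists2 x, D x & forall y, D y -> f y <= f x + e.
Proof.
move=> Dx0 fB e0; pose A := [set f x | x in D].
have supA : has_sup A.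
  by split; [exists (f x0); exists x0 | exists B => _ [x Dx <-]; exact: fB].
have [_ [x Dx <-] Hx] := sup_adherent e0 supA.
exists x => // y Dy; have := sup_upper_bound supA (ex_intro2 _ _ y Dy erefl).
by move: Hx; lra.
Qed.

Variables (n : nat) (c : 'I_n -> R).
Hypothesis c_ge0 : forall i, 0 <= c i.

(** A step size below which the second order term of the logarithm is harmless,
    uniformly over all perturbations normalised by [\sum_i c i * u i = 1]. *)
Definition small_step : R := (8 * (\sum_i (c i)^-1 + 1))^-1.

Lemma small_step_gt0 : 0 < small_step.
Proof.
rewrite invr_gt0 mulr_gt0 // ltr_wpDl // sumr_ge0 // => i _.
by rewrite invr_ge0.
Qed.

(** Second order expansion of [\sum_i c i * ln (1 + t * u i)] at the small
    step: the quadratic error [2 * t ^+ 2 * \sum_i c i * u i ^+ 2] is controlled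
    by [\sum_i (c i)^-1], since normalisation forces [c i * u i <= 1]. *)
Lemma log_variation (u : 'I_n -> R) (t : R) :
  (forall i, 0 <= u i) -> (forall i, c i = 0 -> u i = 0) ->
  \sum_i c i * u i = 1 -> `|t| = small_step ->
  (forall i, 2^-1 <= 1 + t * u i) /\
  t - `|t| / 4 <= \sum_i c i * ln (1 + t * u i).
Proof.
move=> u0 cu cu1 tE; set U := \sum_i (c i)^-1.
have cV0 i : 0 <= (c i)^-1 by rewrite invr_ge0.
have U0 : 0 <= U by apply: sumr_ge0 => i _.
have tU : `|t| * (8 * (U + 1)) = 1.
  by rewrite tE mulVf // gt_eqF // mulr_gt0 // ltr_wpDl.
have cu_le1 i : c i * u i <= 1.
  rewrite -cu1 (bigD1 i) //= lerDl sumr_ge0 // => j _.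
  by rewrite mulr_ge0.
have u_le i : u i <= (c i)^-1.
  have [ci|ci] := eqVneq (c i) 0; first by rewrite cu // cV0.
  by rewrite -[leRHS]mul1r ler_pdivlMr ?lt0r ?ci //= mulrC.
have u_leU i : u i <= U.
  apply: le_trans (u_le i) _; rewrite /U (bigD1 i) //= lerDl.
  by apply: sumr_ge0.
have tu i : `|t * u i| <= 8^-1.
  rewrite normrM (ger0_norm (u0 i)).
  apply: (le_trans (ler_wpM2l (normr_ge0 t) (u_leU i))).
  by have := normr_ge0 t; lra.
have tu2 i : - 2^-1 <= t * u i by have := tu i; rewrite ler_norml; lra.
split=> [i|]; first by have := tu2 i; lra.
apply: (@le_trans _ _ (\sum_i c i * (t * u i - 2 * (t * u i) ^+ 2))); last first.
  by apply: ler_sum => i _; apply: ler_wpM2l => //; exact: ln_lower_bound.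
have -> : \sum_i c i * (t * u i - 2 * (t * u i) ^+ 2) =
    t - 2 * t ^+ 2 * \sum_i c i * u i ^+ 2.
  transitivity (t * (\sum_i c i * u i) - 2 * t ^+ 2 * \sum_i c i * u i ^+ 2).
    rewrite !mulr_sumr -sumrB; apply: eq_bigr => i _; ring.
  by rewrite cu1 mulr1.
have sum_le : \sum_i c i * u i ^+ 2 <= U.
  apply: ler_sum => i _; rewrite expr2 mulrA.
  apply: le_trans (u_le i); rewrite -[leRHS]mul1r.
  exact: ler_wpM2r.
rewrite lerD2l lerN2 -(real_normK (num_real t)).
have t2 := mulr_ge0 (normr_ge0 t) (normr_ge0 t).
apply: (@le_trans _ _ (2 * `|t| ^+ 2 * U)).
  by apply: ler_wpM2l => //; rewrite mulr_ge0 // sqr_ge0.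
have -> : 2 * `|t| ^+ 2 * U = `|t| * (`|t| * (8 * (U + 1))) / 4 - 2 * (`|t| * `|t|).
  by field.
by rewrite tU mulr1; lra.
Qed.

Variables (w z : 'I_n -> R) (g : R).
Hypothesis w_gt0 : forall i, 0 < c i -> 0 < w i.
Hypothesis z_ge0 : forall i, 0 <= z i.
Hypothesis z_supp : forall i, c i = 0 -> z i = 0.

Let ratio_ge0 i : 0 <= z i / w i.
Proof.
have [ci|ci] := eqVneq (c i) 0; first by rewrite z_supp // mul0r.
by rewrite divr_ge0 // ltW // w_gt0 // lt0r ci c_ge0.
Qed.

Let weighted := \sum_i c i * (z i / w i).

Let weighted_normalised : weighted != 0 -> 
  \sum_i c i * (z i / w i / weighted) = 1.
Proof.
by move=> Q0; under eq_bigr do rewrite mulrA; rewrite -mulr_suml divff.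
Qed.

Let ratio_supp (Q : R) i : c i = 0 -> z i / w i / Q = 0.
Proof. by move=> ci; rewrite z_supp // !mul0r. Qed.

(** First order condition at a near-maximum, for forward perturbations. *)
Lemma weighted_ratio_le :
  (forall t, 0 <= t -> \sum_i c i * ln (1 + t * (z i / w i)) <=
     t * g + small_step / 4) ->
  0 <= g -> \sum_i c i * (z i / w i) <= 2 * g.
Proof.
move=> H g0; rewrite -/weighted; have s0 := small_step_gt0.
have Q_ge0 : 0 <= weighted by apply: sumr_ge0 => i _; exact: mulr_ge0.
have [->|Q0] := eqVneq weighted 0; first by rewrite mulr_ge0.
have Q_gt0 : 0 < weighted by rewrite lt0r Q0.
have /(_ small_step) := @log_variation _ _
  (fun i => divr_ge0 (ratio_ge0 i) Q_ge0) (ratio_supp weighted)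
  (weighted_normalised Q0).
rewrite gtr0_norm // => /(_ erefl) [_ lower].
have := H (small_step / weighted) (divr_ge0 (ltW s0) Q_ge0).
have -> : \sum_i c i * ln (1 + small_step / weighted * (z i / w i)) =
    \sum_i c i * ln (1 + small_step * (z i / w i / weighted)).
  by apply: eq_bigr => i _; congr (_ * ln (1 + _)); rewrite mulrAC !mulrA.
move=> /(le_trans lower); rewrite mulrAC -mulrA -subr_ge0.
have -> : small_step * (g / weighted) + small_step / 4 -
    (small_step - small_step / 4) = small_step * (g / weighted - 2^-1) by field.
by rewrite pmulr_rge0 // subr_ge0 ler_pdivlMr //; lra.
Qed.

(** First order condition at a near-maximum, for backward perturbations. *)
Lemma le_weighted_ratio :
  (forall t, 0 <= t -> (forall i, 2^-1 <= 1 - t * (z i / w i)) ->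
     \sum_i c i * ln (1 - t * (z i / w i)) <= - t * g + small_step / 4) ->
  g <= 2 * \sum_i c i * (z i / w i).
Proof.
move=> H; rewrite -/weighted; have s0 := small_step_gt0.
have Q_ge0 : 0 <= weighted by apply: sumr_ge0 => i _; exact: mulr_ge0.
have [Q0|Q0] := eqVneq weighted 0.
  have ratio0 i : z i / w i = 0.
    have [ci|ci] := eqVneq (c i) 0; first by rewrite z_supp // mul0r.
    move/eqP: Q0; rewrite psumr_eq0 => [/allP /(_ i (mem_index_enum _))|j _].
      by rewrite mulf_eq0 (negbTE ci) => /eqP.
    exact: mulr_ge0.
  (* All ratios vanish, so arbitrarily long steps are admissible. *)
  rewrite Q0 mulr0 leNgt; apply/negP => g0.
  have := H (small_step / g) (divr_ge0 (ltW s0) (ltW g0)).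
  rewrite big1 => [|i _]; last by rewrite ratio0 mulr0 subr0 ln1 mulr0.
  rewrite mulNr divfK ?gt_eqF //.
  have h i : 2^-1 <= 1 - small_step / g * (z i / w i).
    by rewrite ratio0 mulr0; lra.
  by move=> /(_ h); lra.
have Q_gt0 : 0 < weighted by rewrite lt0r Q0.
have /(_ (- small_step)) := @log_variation _ _
  (fun i => divr_ge0 (ratio_ge0 i) Q_ge0) (ratio_supp weighted)
  (weighted_normalised Q0).
rewrite normrN gtr0_norm // => /(_ erefl) [half lower].
have tE i : 1 - small_step / weighted * (z i / w i) =
    1 + - small_step * (z i / w i / weighted).
  by rewrite mulNr; congr (1 - _); rewrite mulrAC !mulrA.
have := H (small_step / weighted) (divr_ge0 (ltW s0) Q_ge0).
under eq_bigr do rewrite tE.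
have h i : 2^-1 <= 1 - small_step / weighted * (z i / w i) by rewrite tE.
move=> /(_ h) /(le_trans lower); rewrite -subr_ge0.
have -> : - (small_step / weighted) * g + small_step / 4 -
    (- small_step - small_step / 4) = small_step * (3 / 2 - g / weighted) by field.
by rewrite pmulr_rge0 // subr_ge0 ler_pdivrMr //; lra.
Qed.

End LogarithmicVariation.

(** * Entropy maximisation over finite families *)

Section Families.
Context {R : realType} {k : scalar_kind}.
Local Notation K := (scalars R k).
Implicit Types (x z : nat -> K) (s : seq (nat -> K)).
Variables (E : seq_space R k) (n : nat) (r : R).
Hypothesis hE : symmetric_seq_space E.
Hypothesis r1 : 1 <= r.

Let r_gt0 : 0 < r. Proof. exact: lt_le_trans ltr01 r1. Qed.

(** The two sides of the convexity and concavity inequalities raised to the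
    power [r], where both become additive under concatenation of families. *)
Definition lattice_sum s (i : nat) : R := \sum_(z <- s) modulus (z i) `^ r.

Definition norm_sum s : R := \sum_(z <- s) seq_norm E (trunc n z) `^ r.

(** With [w := lattice_sum s] this is, on the first [n] coordinates, the
    lattice [l_r]-sum of the family [s]. *)
Definition root_seq (w : nat -> R) : nat -> K :=
  trunc n (fun i => of_real k (w i `^ r^-1)).

Lemma lattice_sum_ge0 s i : 0 <= lattice_sum s i.
Proof. by apply: sumr_ge0 => z _; exact: powR_ge0. Qed.

Lemma norm_sum_ge0 s : 0 <= norm_sum s.
Proof. by apply: sumr_ge0 => z _; exact: powR_ge0. Qed.

Lemma norm_sum_cons z s :
  norm_sum (z :: s) = seq_norm E (trunc n z) `^ r + norm_sum s.
Proof. by rewrite /norm_sum big_cons. Qed.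

Lemma lattice_sum_cons z s i :
  lattice_sum (z :: s) i = modulus (z i) `^ r + lattice_sum s i.
Proof. by rewrite /lattice_sum big_cons. Qed.

Lemma carrier_trunc z : carrier E (trunc n z).
Proof. by apply: (carrier_finsupp hE (n := n)); exact: finsupp_trunc. Qed.

Lemma ler_lattice_norm_sum s i : (i < n)%N -> lattice_sum s i <= norm_sum s.
Proof.
move=> iltn; apply: ler_sum => z _; rewrite ler_powR_pos ?modulus_ge0 //.
  have := ler_coord_sym_norm hE i (carrier_trunc z).
  by rewrite /trunc iltn.
exact: sym_norm_ge0 (carrier_trunc z).
Qed.

Let fin_lnorm_seq (T : Type) (z0 : T) (l : seq T) (f : T -> R) :
  fin_lnorm r%:E (fun j : 'I_(size l) => f (nth z0 l j)) =
  (\sum_(z <- l) f z `^ r) `^ r^-1.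
Proof. by rewrite /= (big_nth z0) big_mkord. Qed.

Let fam s (j : 'I_(size s)) := trunc n (nth (fun=> 0) s j).

Let lattice_fam s : lattice_lnorm r%:E (@fam s) =1 root_seq (lattice_sum s).
Proof.
move=> i; rewrite /lattice_lnorm /fam /root_seq /trunc.
case: ifP => _.
  by rewrite (fin_lnorm_seq (fun=> 0) s (fun z => modulus (z i))).
under eq_fin_lnorm do rewrite modulus0.
rewrite (@eq_fin_lnorm _ _ _ _ (fun j => 0 * 0)); last by move=> j; rewrite mul0r.
by rewrite fin_lnormZ // mul0r of_real0.
Qed.

Lemma p_convex_norm_sum (C : R) :
  (forall m (x : 'I_m -> nat -> K), (forall j, carrier E (x j)) ->
    seq_norm E (lattice_lnorm r%:E x) <=
    C * fin_lnorm r%:E (fun j => seq_norm E (x j))) ->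
  forall s, seq_norm E (root_seq (lattice_sum s)) <= C * norm_sum s `^ r^-1.
Proof.
move=> HC s; have := HC _ (@fam s) (fun j => carrier_trunc _).
rewrite (sym_norm_ext E (lattice_fam s)).
by rewrite (fin_lnorm_seq (fun=> 0) s (fun z => seq_norm E (trunc n z))).
Qed.

Lemma q_concave_norm_sum (C : R) :
  (forall m (x : 'I_m -> nat -> K), (forall j, carrier E (x j)) ->
    fin_lnorm r%:E (fun j => seq_norm E (x j)) <=
    C * seq_norm E (lattice_lnorm r%:E x)) ->
  forall s, norm_sum s `^ r^-1 <= C * seq_norm E (root_seq (lattice_sum s)).
Proof.
move=> HC s; have := HC _ (@fam s) (fun j => carrier_trunc _).
rewrite (sym_norm_ext E (lattice_fam s)).
by rewrite (fin_lnorm_seq (fun=> 0) s (fun z => seq_norm E (trunc n z))).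
Qed.

(** The upper bound that makes the entropy functionals below bounded. *)
Lemma weighted_ln_le (c w : 'I_n -> R) (S : R) :
  (forall i, 0 <= c i) -> \sum_i c i = 1 -> (forall i, 0 < c i -> 0 < w i) ->
  (forall i, w i <= S) -> \sum_i c i * ln (w i) <= ln S.
Proof.
move=> c0 c1 w0 wS; rewrite -[leRHS]mul1r -c1 mulr_suml.
apply: ler_sum => i _; have [ci|ci] := eqVneq (c i) 0; first by rewrite ci !mul0r.
have wi : 0 < w i by rewrite w0 // lt0r ci c0.
by apply: ler_wpM2l => //; rewrite ler_ln ?posrE // (lt_le_trans wi).
Qed.

(** A Lozanovskii-type factorization for the cone of lattice sums: maximise
    [\sum_i c i * ln (w i) - ln S] over finite families, where [w] is the
    lattice sum and [S] the sum of norms. Enlarging a near-optimal family by a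
    multiple of [z] gives the stated inequality, because lattice sums and
    norm sums are both additive. *)
Lemma lattice_sum_factorization (c : 'I_n -> R) :
  (forall i, 0 <= c i) -> \sum_i c i = 1 ->
  exists s, [/\ forall i, (i < n)%N -> 0 < lattice_sum s i, 0 < norm_sum s &
    forall z, (forall i : 'I_n, c i = 0 -> z i = 0) ->
    \sum_i c i * (modulus (z i) `^ r / lattice_sum s i) <=
      2 * (seq_norm E (trunc n z) `^ r / norm_sum s)].
Proof.
move=> c0 c1.
have n_gt0 : (0 < n)%N.
  case: (posnP n) => // n0; move: c1; rewrite big1 ?[_ = 1]eq_sym => [/eqP|i _].
    by rewrite eq_sym oner_eq0.
  by have := ltn_ord i; rewrite {2}n0.
pose D s := forall i, (i < n)%N -> 0 < lattice_sum s i.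
pose f s := \sum_(i < n) c i * ln (lattice_sum s i) - ln (norm_sum s).
have S_gt0 s : D s -> 0 < norm_sum s.
  by move=> Ds; apply: lt_le_trans (Ds _ n_gt0) (ler_lattice_norm_sum s n_gt0).
have Done : D [:: fun=> 1].
  by move=> i _; rewrite /lattice_sum big_seq1 modulus1 powR1.
have f_le0 s : D s -> f s <= 0.
  move=> Ds; rewrite subr_le0; apply: weighted_ln_le => // i; first by rewrite Ds.
  exact: ler_lattice_norm_sum.
have e0 : 0 < small_step c / 4 by rewrite divr_gt0 // small_step_gt0.
have [s Ds Hs] := near_maximum Done f_le0 e0.
have Ss := S_gt0 _ Ds.
exists s; split=> // z cz.
apply: (@weighted_ratio_le _ _ c c0 (fun i => lattice_sum s i)
  (fun i => modulus (z i) `^ r)) => [i _|i|i ci|t t0|].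
- by rewrite Ds.
- exact: powR_ge0.
- by rewrite cz // modulus0 powR0 // gt_eqF.
- pose z' := (fun i => of_real k (t `^ r^-1) * z i).
  have Wz' i : lattice_sum (z' :: s) i = lattice_sum s i + t * modulus (z i) `^ r.
    rewrite lattice_sum_cons modulusM modulus_of_real ger0_norm ?powR_ge0 //.
    by rewrite powRM ?powR_ge0 ?modulus_ge0 // powR_invK // addrC.
  have Nz' : norm_sum (z' :: s) = norm_sum s + t * seq_norm E (trunc n z) `^ r.
    rewrite norm_sum_cons addrC; congr (_ + _).
    have -> : seq_norm E (trunc n z') = t `^ r^-1 * seq_norm E (trunc n z).
      have <- : modulus (of_real k (t `^ r^-1)) = t `^ r^-1.
        by rewrite modulus_of_real ger0_norm // powR_ge0.
      rewrite -(sym_norm_scale hE _ (carrier_trunc z)).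
      by apply: sym_norm_ext => i; rewrite /trunc; case: ifP => //; rewrite mulr0.
    rewrite powRM ?powR_ge0 ?powR_invK //.
    exact: sym_norm_ge0 (carrier_trunc z).
  have Dz' : D (z' :: s).
    by move=> i /Ds wi; rewrite Wz' ltr_wpDr // mulr_ge0 // powR_ge0.
  have := Hs _ Dz'; rewrite /f Nz'.
  have -> : \sum_(i < n) c i * ln (lattice_sum (z' :: s) i) =
      \sum_(i < n) c i * ln (1 + t * (modulus (z i) `^ r / lattice_sum s i)) +
      \sum_(i < n) c i * ln (lattice_sum s i).
    rewrite -big_split /=; apply: eq_bigr => i _; rewrite -mulrDr; congr (_ * _).
    have wi := Ds i (ltn_ord i).
    rewrite -lnM ?posrE //; last first.
      by rewrite ltr_wpDr // mulr_ge0 // divr_ge0 ?powR_ge0 // ltW.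
    by congr ln; rewrite Wz'; field; rewrite gt_eqF.
  have g0 : 0 <= t * (seq_norm E (trunc n z) `^ r / norm_sum s).
    by rewrite mulr_ge0 // divr_ge0 ?powR_ge0 // ltW.
  have -> : norm_sum s + t * seq_norm E (trunc n z) `^ r =
      (1 + t * (seq_norm E (trunc n z) `^ r / norm_sum s)) * norm_sum s.
    by field; rewrite gt_eqF.
  rewrite lnM ?posrE // ?ltr_wpDr //.
  have : ln (1 + t * (seq_norm E (trunc n z) `^ r / norm_sum s)) <=
      t * (seq_norm E (trunc n z) `^ r / norm_sum s).
    by apply: le_ln1Dx; lra.
  lra.
- by rewrite divr_ge0 ?powR_ge0 // ltW.
Qed.

End Families.

(** * Factoring l_p through a p-convex space *)

Lemma sum_stationary (V : zmodType) (n m : nat) (f : nat -> V) : (n <= m)%N ->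
  (forall i, (n <= i)%N -> f i = 0) -> \sum_(0 <= i < m) f i = \sum_(i < n) f i.
Proof.
move=> nm fn; rewrite (big_cat_nat (n := n)) //= big_mkord.
rewrite [X in _ + X]big_nat_cond [X in _ + X]big1 ?addr0 //.
by move=> i /andP[/andP[ni _] _]; exact: fn.
Qed.

Section Weights.
Context {R : realType} {k : scalar_kind}.
Local Notation K := (scalars R k).
Variables (n : nat) (r : R) (x : nat -> K).
Hypothesis r1 : 1 <= r.

Let r_gt0 : 0 < r. Proof. exact: lt_le_trans ltr01 r1. Qed.

Let X := fin_lnorm r%:E (fun i : 'I_n => modulus (x i)).

Hypothesis X_gt0 : 0 < X.

(** These are probability weights; the entropy functionals are taken with
    respect to them. *)
Definition lnorm_weight (i : nat) : R :=
  (modulus (x i) / fin_lnorm r%:E (fun i : 'I_n => modulus (x i))) `^ r.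

Lemma lnorm_weight_ge0 i : 0 <= lnorm_weight i.
Proof. exact: powR_ge0. Qed.

Lemma lnorm_weight_sum : \sum_(i < n) lnorm_weight i = 1.
Proof.
rewrite /lnorm_weight -/X.
under eq_bigr do rewrite powRM ?modulus_ge0 ?invr_ge0 ?(ltW X_gt0) //.
rewrite -mulr_suml -fin_lnorm_powR // -/X -powRM ?invr_ge0 ?ltW //.
by rewrite divff ?powR1 // gt_eqF.
Qed.

Lemma lnorm_weight_eq0 i : (lnorm_weight i == 0) = (x i == 0).
Proof.
rewrite /lnorm_weight -/X powR_eq0 mulf_eq0 invr_eq0 modulus_eq0.
by rewrite (gt_eqF X_gt0) (gt_eqF r_gt0) orbF andbT.
Qed.

End Weights.

Section Factorization.
Context {R : realType} {k : scalar_kind}.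
Local Notation K := (scalars R k).

Lemma sum_supp_le (n m : nat) (f : nat -> R) : (forall i, 0 <= f i) ->
  (forall i, (n <= i)%N -> f i = 0) -> \sum_(i < m) f i <= \sum_(i < n) f i.
Proof.
move=> f0 fn; have [mn|/ltnW nm] := leqP m n.
  rewrite -!(big_mkord xpredT) [leRHS](big_cat_nat (n := m)) //= lerDl.
  by apply: sumr_ge0.
by rewrite -(big_mkord xpredT) (sum_stationary nm fn).
Qed.

Lemma powR_div (u v s : R) : 0 <= u -> 0 <= v -> (u / v) `^ s = u `^ s / v `^ s.
Proof.
move=> u0 v0; rewrite powRM ?invr_ge0 //.
by rewrite -(powR_inv1 v0) powRAC powR_inv1 // powR_ge0.
Qed.

Lemma le_powR_pow2 (r s L : R) : 1 <= r -> 0 <= s -> 0 <= L ->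
  s `^ r <= 2 * L `^ r -> s <= 2 * L.
Proof.
move=> r1 s0 L0 H; have r0 : 0 < r := lt_le_trans ltr01 r1.
rewrite -(ler_powR_pos r0) ?mulr_ge0 //; apply: le_trans H _.
by rewrite powRM // ler_wpM2r ?powR_ge0 // le1r_powR // ler1n.
Qed.

(** With [w] and [S] provided by the variational principle for the weights of
    [x], take [a i = |x i| / (||x||_r * (w i / S)^(1/r))] and [e = x / a].
    The first order condition says that [a] is a multiplier into l_r, and
    convexity bounds [e], as [|e|] is at most [||x||_r * (w / S)^(1/r)]. *)
Lemma p_convex_factorization_finite (E : seq_space R k) (r C : R) :
  1 <= r -> symmetric_seq_space E ->
  (forall m (x : 'I_m -> nat -> K), (forall j, carrier E (x j)) ->
    seq_norm E (lattice_lnorm r%:E x) <=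
    C * fin_lnorm r%:E (fun j => seq_norm E (x j))) ->
  forall n (x : nat -> K),
  let X := fin_lnorm r%:E (fun i : 'I_n => modulus (x i)) in 0 < X ->
  exists (a : nat -> R) (e : nat -> K),
  [/\ forall i, 0 <= a i, finsupp n e,
      forall i, (i < n)%N -> x i = of_real k (a i) * e i,
      seq_norm E e <= C * X &
      forall z, carrier E z ->
        lnorm_le r%:E (fun i => a i * modulus (z i)) (2 * seq_norm E z)].
Proof.
move=> r1 hE HC n x X X0; have r0 : 0 < r := lt_le_trans ltr01 r1.
pose c (i : nat) := lnorm_weight n r x i.
have c0 i : 0 <= c i by exact: lnorm_weight_ge0.
have cx i : (c i == 0) = (x i == 0) by exact: lnorm_weight_eq0.
have [s [w0 S0 Hs]] := lattice_sum_factorization hE r1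
  (fun i : 'I_n => c0 i) (lnorm_weight_sum r1 X0).
set w := lattice_sum r s in w0 Hs; set S := norm_sum E n r s in S0 Hs.
have wS0 i : 0 <= w i / S by rewrite divr_ge0 ?(ltW S0) //; exact: lattice_sum_ge0.
pose a i := if (i < n)%N then (c i / (w i / S)) `^ r^-1 else 0.
have a0 i : 0 <= a i by rewrite /a; case: ifP => // _; exact: powR_ge0.
have a_eq0 i : (i < n)%N -> (a i == 0) = (x i == 0).
  move=> ilt; rewrite /a ilt powR_eq0 invr_eq0 (gt_eqF r0) andbT.
  by rewrite mulf_eq0 invr_eq0 cx (gt_eqF (divr_gt0 (w0 i ilt) S0)) orbF.
pose e i := of_real k (a i)^-1 * x i.
have xE i : (i < n)%N -> x i = of_real k (a i) * e i.
  move=> ilt; rewrite /e mulrA -of_realM.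
  have [xi|xi] := eqVneq (x i) 0; first by rewrite xi mulr0.
  by rewrite divff ?of_real1 ?mul1r // a_eq0.
have modulus_e i : modulus (e i) = (a i)^-1 * modulus (x i).
  by rewrite /e modulusM modulus_of_real ger0_norm // invr_ge0.
have aE i : (i < n)%N ->
    a i = modulus (x i) / X / (w i `^ r^-1 / S `^ r^-1).
  move=> ilt; rewrite /a ilt powR_div // powR_div ?(ltW S0) ?(ltW (w0 i ilt)) //.
  congr (_ / _); rewrite /c /lnorm_weight -/X powRK_inv //.
  by rewrite divr_ge0 ?modulus_ge0 // ltW.
have esupp : finsupp n e.
  by move=> i ni; rewrite /e /a ltnNge ni /= invr0 of_real0 mul0r.
exists a, e; split=> //.
- pose g := root_seq (k := k) n r w.
  have gsupp : carrier E g by exact: carrier_trunc.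
  have Ng : seq_norm E g <= C * S `^ r^-1 by exact: p_convex_norm_sum.
  pose t := X / S `^ r^-1.
  have t0 : 0 <= t by rewrite divr_ge0 ?powR_ge0 ?ltW.
  have -> : C * X = t * (C * S `^ r^-1).
    by rewrite /t; field; rewrite gt_eqF // powR_gt0.
  apply: le_trans (ler_wpM2l t0 Ng).
  have -> : t = modulus (of_real k t) by rewrite modulus_of_real ger0_norm.
  rewrite -(sym_norm_scale hE _ gsupp); apply: sym_mono => //.
  + exact: carrier_finsupp hE _ _ esupp.
  + exact: sym_scale.
  move=> i; have [ni|ilt] := leqP n i; first by rewrite esupp // modulus0 modulus_ge0.
  rewrite [leRHS]modulusM /g /root_seq /trunc ilt !modulus_of_real.
  rewrite (ger0_norm t0) (ger0_norm (powR_ge0 _ _)).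
  rewrite modulus_e.
  have [xi|xi] := eqVneq (x i) 0.
    by rewrite xi modulus0 mulr0; apply: mulr_ge0 => //; exact: powR_ge0.
  have ai : 0 < a i by rewrite lt0r a0 a_eq0 // xi.
  rewrite mulrC ler_pdivrMr // aE // le_eqVlt; apply/orP; left; apply/eqP.
  have cancel_factors (m u v y : R) : 0 < u -> 0 < v -> 0 < y ->
      m = u / v * y * (m / u / (y / v)).
    by move=> u0 v0 y0; field; rewrite !gt_eqF.
  apply: cancel_factors => //; apply: powR_gt0 => //; exact: w0.
- move=> z Ez m; have N0 := sym_norm_ge0 hE Ez.
  apply: (le_powR_pow2 r1) => //; first exact: fin_lnorm_ge0.
  rewrite fin_lnorm_powR //.
  pose z' i := if c i == 0 then 0 else z i.
  have cz' (i : 'I_n) : c i = 0 -> z' i = 0 by rewrite /z' => ->; rewrite eqxx.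
  have /= := Hs z' cz'.
  have Nz' : seq_norm E (trunc n z') <= seq_norm E z.
    apply: sym_mono => //; first exact: carrier_trunc.
    move=> i; rewrite /trunc /z'; case: ifP => _; last by rewrite modulus0 modulus_ge0.
    by case: ifP => _ //; rewrite modulus0 modulus_ge0.
  have Nz'r : seq_norm E (trunc n z') `^ r <= seq_norm E z `^ r.
    by rewrite ler_powR_pos // (sym_norm_ge0 hE) //; exact: carrier_trunc.
  move=> H; apply: (@le_trans _ _ (\sum_(i < n) (a i * modulus (z i)) `^ r)).
    apply: (@sum_supp_le n m (fun i => (a i * modulus (z i)) `^ r)) => [i|i ni].
      exact: powR_ge0.
    by rewrite /a ltnNge ni /= mul0r powR0 // gt_eqF.
  apply: (@le_trans _ _ (S * (2 * (seq_norm E (trunc n z') `^ r / S)))); last first.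
    have -> : S * (2 * (seq_norm E (trunc n z') `^ r / S)) =
      2 * seq_norm E (trunc n z') `^ r by field; rewrite gt_eqF.
    by apply: ler_wpM2l.
  apply: le_trans (ler_wpM2l (ltW S0) H); rewrite mulr_sumr.
  apply: ler_sum => i _; rewrite powRM ?modulus_ge0 // /a ltn_ord powR_invK //; last first.
    by rewrite mulr_ge0 ?invr_ge0.
  rewrite le_eqVlt; apply/orP; left; apply/eqP; rewrite /z'.
  have wi := w0 i (ltn_ord i).
  have [ci|ci] := eqVneq (c i) 0; first by rewrite ci !mul0r mulr0.
  by field; rewrite !gt_eqF.
Qed.

(** Up to constants, l_p is the product of [E] and of the space of multipliers
    from [E] to l_p. For [p] infinite the constant multiplier one works, since
    convexity bounds the norm of [E] by the supremum norm on finite sequences. *)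
Lemma p_convex_factorization (E : seq_space R k) (p : \bar R) :
  (1 <= p)%E -> symmetric_seq_space E -> p_convex p E ->
  exists2 C : R, 0 < C & forall n (x : nat -> K),
  exists (a : nat -> R) (e : nat -> K),
  [/\ forall i, 0 <= a i, finsupp n e,
      forall i, (i < n)%N -> x i = of_real k (a i) * e i,
      seq_norm E e <= C * fin_lnorm p (fun i : 'I_n => modulus (x i)) &
      forall z, carrier E z ->
        lnorm_le p (fun i => a i * modulus (z i)) (C * seq_norm E z)].
Proof.
(* [C] is for the norm of [e] and [2] for the multiplier [a]. *)
move=> p1 hE [C C0 HC]; exists (C + 2); first by rewrite addr_gt0.
have C2 : C <= C + 2 by rewrite lerDl.
have C2' : 2 <= C + 2 by rewrite lerDr ltW.
case/exponentP: p1 HC => [r r1|] HC n x; last first.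
  exists (fun=> 1), (trunc n x); split=> //.
  - exact: finsupp_trunc.
  - by move=> i ilt; rewrite /trunc ilt of_real1 mul1r.
  - pose f (j : 'I_n) := (fun i => x j * unit_seq j i) : nat -> K.
    have Ef j : carrier E (f j) by apply: (sym_scale hE); exact: (carrier_unit_seq hE j).1.
    have := HC n f Ef.
    have lnorm_f i : fin_lnorm +oo%E (fun j => modulus (f j i)) = modulus (trunc n x i).
      apply/eqP; rewrite eq_le; apply/andP; split.
        apply: bigmax_le => [|j _]; first exact: modulus_ge0.
        rewrite /f modulusM /unit_seq; have [->|_] := eqVneq i (j : nat).
          by rewrite modulus1 mulr1 /trunc ltn_ord.
        by rewrite modulus0 mulr0 modulus_ge0.
      rewrite /trunc; case: ifP => ilt; last first.
        by rewrite modulus0; exact: (@fin_lnorm_ge0 _ +oo%E).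
      apply: le_trans (le_bigmax _ _ (Ordinal ilt)).
      by rewrite /f modulusM /unit_seq eqxx modulus1 mulr1.
    have -> : seq_norm E (lattice_lnorm +oo%E f) = seq_norm E (trunc n x).
      apply: (sym_norm_modulus hE); last first.
      + by move=> i; rewrite /lattice_lnorm lnorm_f modulus_of_real ger0_norm ?modulus_ge0.
      + exact: carrier_trunc.
      apply: (carrier_finsupp hE (n := n)) => i ni.
      by rewrite /lattice_lnorm lnorm_f /trunc ltnNge ni modulus0 of_real0.
    move=> H; apply: le_trans H _.
    have fE : (fun j => seq_norm E (f j)) = (fun j : 'I_n => modulus (x j)).
      apply/funext => j; have [Ej Nj] := carrier_unit_seq hE j.
      by rewrite /f (sym_norm_scale hE _ Ej) Nj mulr1.
    by rewrite fE; apply: ler_wpM2r => //; exact: fin_lnorm_ge0.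
  - move=> z Ez m; have N0 := sym_norm_ge0 hE Ez.
    apply: bigmax_le => [|j _]; first by rewrite mulr_ge0 // ltW // addr_gt0.
    rewrite mul1r; apply: le_trans (ler_coord_sym_norm hE j Ez) _.
    by rewrite ler_peMl //; lra.
set X := fin_lnorm _ _.
have [X0|X0] := eqVneq X 0.
  exists (fun=> 0), (fun=> 0); split=> //.
  - move=> i ilt; rewrite mulr0; apply/eqP.
    have mx0 (j : 'I_n) : 0 <= modulus (x j) by exact: modulus_ge0.
    have := @ler_coord_fin_lnorm _ r%:E n (fun j => modulus (x j)) (Ordinal ilt) r1 mx0.
    by rewrite -/X X0 /= -modulus_eq0 eq_le modulus_ge0 andbT.
  - by rewrite sym_norm0 // X0 mulr0.
  - move=> z Ez m; have N0 := sym_norm_ge0 hE Ez.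
    have mz0 (j : 'I_m) : 0 <= modulus (z j) by exact: modulus_ge0.
    by rewrite fin_lnormZ // mul0r mulr_ge0 // ltW // addr_gt0.
have X_gt0 : 0 < X by rewrite lt0r X0 fin_lnorm_ge0.
have [a [e [a0 esupp xE Ne aM]]] :=
  p_convex_factorization_finite r1 hE HC X_gt0.
exists a, e; split=> //.
  by apply: le_trans Ne _; rewrite ler_wpM2r // ltW.
move=> z Ez m; apply: le_trans (aM z Ez m) _.
by rewrite ler_wpM2r // sym_norm_ge0.
Qed.

End Factorization.

(** * The superadditive envelope of a concave space *)

Section ConcaveEnvelope.
Context {R : realType} {k : scalar_kind}.
Local Notation K := (scalars R k).
Variables (F : seq_space R k) (n : nat) (r C : R).
Hypothesis hF : symmetric_seq_space F.
Hypothesis r1 : 1 <= r.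
Hypothesis concaveF : forall m (x : 'I_m -> nat -> K), (forall j, carrier F (x j)) ->
  fin_lnorm r%:E (fun j => seq_norm F (x j)) <=
  C * seq_norm F (lattice_lnorm r%:E x).
Hypothesis C_gt0 : 0 < C.
Implicit Types (w : nat -> R) (z : nat -> K).

Let r_gt0 : 0 < r. Proof. exact: lt_le_trans ltr01 r1. Qed.

Definition decompositions w : set (seq (nat -> K)) :=
  [set s | forall i, (i < n)%N -> lattice_sum r s i = w i].

(** The least superadditive majorant of [w |-> ||w^(1/r)||^r]; concavity says
    that it is equivalent to this function. *)
Definition envelope w : R := sup [set norm_sum F n r s | s in decompositions w].

Local Notation root_norm w := (seq_norm F (root_seq (k := k) n r w)).

Let root_norm_ge0 w : 0 <= root_norm w.
Proof. by apply: (sym_norm_ge0 hF); exact: carrier_trunc. Qed.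

Let root_seq_decomposition w : (forall i, (i < n)%N -> 0 <= w i) ->
  decompositions w [:: root_seq n r w].
Proof.
move=> w0 i ilt; rewrite /lattice_sum big_seq1 /root_seq /trunc ilt.
by rewrite modulus_of_real ger0_norm ?powR_ge0 // powR_invK // w0.
Qed.

Let norm_sum_decomposition w s : decompositions w s ->
  norm_sum F n r s <= (C * root_norm w) `^ r.
Proof.
move=> ws; have := q_concave_norm_sum n hF r1 concaveF s.
have -> : root_seq n r (lattice_sum r s) = root_seq n r w :> (nat -> K).
  by apply/funext => i; rewrite /root_seq /trunc; case: ifP => // /ws ->.
have CN0 : 0 <= C * root_norm w by rewrite mulr_ge0 // ltW.
have N0 := norm_sum_ge0 F n r s.
move=> H; rewrite -(powR_invK r_gt0 N0) ler_powR_pos //; exact: powR_ge0.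
Qed.

Let has_sup_envelope w : (forall i, (i < n)%N -> 0 <= w i) ->
  has_sup [set norm_sum F n r s | s in decompositions w].
Proof.
move=> w0; split.
  exists (norm_sum F n r [:: root_seq n r w]); exists [:: root_seq n r w] => //.
  exact: root_seq_decomposition.
by exists ((C * root_norm w) `^ r) => _ [s ws <-]; exact: norm_sum_decomposition.
Qed.

Lemma le_envelope w s : (forall i, (i < n)%N -> 0 <= w i) ->
  decompositions w s -> norm_sum F n r s <= envelope w.
Proof.
by move=> w0 ws; apply: (sup_upper_bound (has_sup_envelope w0)); exists s.
Qed.

Lemma envelope_le w : (forall i, (i < n)%N -> 0 <= w i) ->
  envelope w <= (C * root_norm w) `^ r.
Proof.
move=> w0; apply: ge_sup; first by case: (has_sup_envelope w0).
by move=> _ [s ws <-]; exact: norm_sum_decomposition.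
Qed.

Lemma ler_coord_envelope w i : (forall i, (i < n)%N -> 0 <= w i) -> (i < n)%N ->
  w i <= envelope w.
Proof.
move=> w0 ilt; have ws := root_seq_decomposition w0.
apply: le_trans (le_envelope w0 ws); rewrite -(ws i ilt).
exact: (ler_lattice_norm_sum hF r1).
Qed.

(** The point of passing to the envelope: it is exactly superadditive, while
    concavity only provides superadditivity up to a constant. *)
Lemma envelope_superadditive w w' z :
  (forall i, (i < n)%N -> 0 <= w' i) ->
  (forall i, (i < n)%N -> w i = w' i + modulus (z i) `^ r) ->
  envelope w' + seq_norm F (trunc n z) `^ r <= envelope w.
Proof.
move=> w'0 wE; rewrite -lerBrDr; apply: ge_sup; first by case: (has_sup_envelope w'0).
move=> _ [s ws <-]; rewrite lerBrDr addrC -norm_sum_cons; apply: le_envelope.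
  by move=> i ilt; rewrite wE // addr_ge0 ?w'0 // powR_ge0.
by move=> i ilt; rewrite lattice_sum_cons ws // wE // addrC.
Qed.

(** Maximise [\sum_i c i * ln (w i) - ln (envelope w)]; removing a small
    multiple of [|z|^r] from a near-optimal [w] gives the stated inequality. *)
Lemma envelope_factorization (c : nat -> R) :
  (forall i, 0 <= c i) -> \sum_(i < n) c i = 1 ->
  exists w, [/\ forall i, 0 <= w i, forall i, 0 < c i -> 0 < w i,
    forall i, c i = 0 -> w i = 0, 0 < envelope w &
    forall z, (forall i, c i = 0 -> z i = 0) ->
    seq_norm F (trunc n z) `^ r / envelope w <=
    2 * \sum_(i < n) c i * (modulus (z i) `^ r / w i)].
Proof.
move=> c0 c1.
have [l cl] : exists l : 'I_n, 0 < c l.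
  apply/existsP; apply: contra_eqT c1 => /existsPn H.
  have -> : \sum_(i < n) c i = 0.
    by apply: big1 => i _; apply/eqP; rewrite eq_le c0 leNgt H.
  by rewrite eq_sym oner_eq0.
pose D w := [/\ forall i, 0 <= w i, forall i, 0 < c i -> 0 < w i &
  forall i, c i = 0 -> w i = 0].
pose f w := \sum_(i < n) c i * ln (w i) - ln (envelope w).
have G_gt0 w : D w -> 0 < envelope w.
  move=> [w0 wc _]; apply: lt_le_trans (wc _ cl) _.
  by apply: ler_coord_envelope => // i _.
have Dc : D c by split.
have f_le0 w : D w -> f w <= 0.
  move=> [w0 wc _]; rewrite subr_le0.
  apply: (@weighted_ln_le _ n (fun i => c i) (fun i => w i)) => // i; first exact: wc.
  by apply: ler_coord_envelope => // j _.
have e0 : 0 < small_step (fun i : 'I_n => c i) / 4.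
  by rewrite divr_gt0 //; exact: small_step_gt0.
have [w Dw Hw] := near_maximum Dc f_le0 e0.
have Gw := G_gt0 _ Dw; have [w0 wc wz] := Dw.
exists w; split=> // z cz.
apply: (@le_weighted_ratio _ _ (fun i : 'I_n => c i) (fun i => c0 i) (fun i => w i)
  (fun i => modulus (z i) `^ r)) => [i|i|i ci|t t0 half].
- exact: wc.
- exact: powR_ge0.
- by rewrite cz // modulus0 powR0 // gt_eqF.
pose w' i := if (i < n)%N then w i - t * modulus (z i) `^ r else w i.
have wE i : 0 < c i -> (i < n)%N -> w' i = w i * (1 - t * (modulus (z i) `^ r / w i)).
  by move=> ci ilt; rewrite /w' ilt; field; rewrite gt_eqF // wc.
have w'c i : 0 < c i -> 0 < w' i.
  move=> ci; case: (ltnP i n) => ilt; last by rewrite /w' ltnNge ilt /= wc.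
  rewrite wE // mulr_gt0 ?wc //.
  by have := half (Ordinal ilt); apply: lt_le_trans; rewrite invr_gt0.
have w'z i : c i = 0 -> w' i = 0.
  move=> ci; rewrite /w' wz // cz // modulus0 powR0 ?gt_eqF // mulr0 subr0.
  by case: ifP.
have Dw' : D w'.
  split=> // i; have [ci|ci] := eqVneq (c i) 0; first by rewrite w'z.
  by rewrite ltW // w'c // lt0r ci c0.
have [w'0 _ _] := Dw'; have Gw' := G_gt0 _ Dw'.
pose z' := (fun i => of_real k (t `^ r^-1) * z i).
have Nz' : seq_norm F (trunc n z') `^ r = t * seq_norm F (trunc n z) `^ r.
  have tz : carrier F (trunc n z) by exact: carrier_trunc.
  have -> : seq_norm F (trunc n z') = t `^ r^-1 * seq_norm F (trunc n z).
    have <- : modulus (of_real k (t `^ r^-1)) = t `^ r^-1.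
      by rewrite modulus_of_real ger0_norm // powR_ge0.
    rewrite -(sym_norm_scale hF _ tz).
    by apply: sym_norm_ext => i; rewrite /trunc; case: ifP => //; rewrite mulr0.
  by rewrite powRM ?powR_ge0 ?powR_invK // (sym_norm_ge0 hF).
have superadd : envelope w' + t * seq_norm F (trunc n z) `^ r <= envelope w.
  rewrite -Nz'; apply: envelope_superadditive => [i _|i ilt]; first exact: w'0.
  rewrite /w' ilt /z' modulusM modulus_of_real ger0_norm ?powR_ge0 //.
  by rewrite powRM ?powR_ge0 ?modulus_ge0 // powR_invK // subrK.
have lnG : ln (envelope w') <=
    ln (envelope w) - t * (seq_norm F (trunc n z) `^ r / envelope w).
  set g := _ / _.
  have le1 : envelope w' / envelope w <= 1 - t * g.
    rewrite ler_pdivrMr // mulrBl mul1r lerBrDr /g mulrA divfK ?gt_eqF //.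
  have : ln (envelope w' / envelope w) <= - (t * g).
    apply: le_trans (le_ln1Dx _); last first.
      by rewrite ltrN2 -subr_gt0; apply: lt_le_trans le1; rewrite divr_gt0.
    by rewrite ler_ln ?posrE ?divr_gt0 //; apply: lt_le_trans le1; rewrite divr_gt0.
  by rewrite ln_div ?posrE //; lra.
have := Hw _ Dw'; rewrite /f.
have -> : \sum_(i < n) c i * ln (w' i) =
    \sum_(i < n) c i * ln (1 - t * (modulus (z i) `^ r / w i)) +
    \sum_(i < n) c i * ln (w i).
  rewrite -big_split /=; apply: eq_bigr => i _; rewrite -mulrDr.
  have [ci|ci] := eqVneq (c i) 0; first by rewrite ci !mul0r.
  have ci0 : 0 < c i by rewrite lt0r ci c0.
  have pos : 0 < 1 - t * (modulus (z i) `^ r / w i).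
    by apply: lt_le_trans (half i); rewrite invr_gt0.
  by rewrite wE // (mulrC (w i)) lnM ?posrE ?wc.
by rewrite mulNr; move: lnG; lra.
Qed.

End ConcaveEnvelope.

(** * Multipliers into a q-concave space *)

Section ConcaveFactorization.
Context {R : realType} {k : scalar_kind}.
Local Notation K := (scalars R k).

(** With [w] provided by the variational principle for the weights [c] of [y]
    and [G] its envelope, take [b i = (w i / (G * c i))^(1/r)]: the first order
    condition bounds [b] as a multiplier from l_r to [F], and [b * y] is the
    root of [w] up to the factor [||y||_r / G^(1/r)], which concavity bounds
    below. *)
Lemma q_concave_factorization_finite (F : seq_space R k) (r C : R) :
  1 <= r -> symmetric_seq_space F -> 0 < C ->
  (forall m (x : 'I_m -> nat -> K), (forall j, carrier F (x j)) ->
    fin_lnorm r%:E (fun j => seq_norm F (x j)) <=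
    C * seq_norm F (lattice_lnorm r%:E x)) ->
  forall n (y : nat -> K),
  let Y := fin_lnorm r%:E (fun i : 'I_n => modulus (y i)) in 0 < Y ->
  exists b : nat -> R,
  [/\ forall i, 0 <= b i, forall i, (n <= i)%N -> b i = 0,
      forall v L, lnorm_le r%:E (fun i => modulus (v i)) L ->
        seq_norm F (fun i => of_real k (b i) * v i) <= 2 * L &
      Y <= C * seq_norm F (fun i => of_real k (b i) * y i)].
Proof.
move=> r1 hF C0 HC n y Y Y0; have r0 : 0 < r := lt_le_trans ltr01 r1.
pose c (i : nat) := lnorm_weight n r y i.
have c0 i : 0 <= c i by exact: lnorm_weight_ge0.
have [w [w0 wc wz G0 Hw]] := envelope_factorization hF r1 HC C0 c0
  (lnorm_weight_sum r1 Y0).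
set G := envelope F n r w in G0 Hw.
pose b i := if (i < n)%N then (w i / (G * c i)) `^ r^-1 else 0.
have b0 i : 0 <= b i by rewrite /b; case: ifP => // _; exact: powR_ge0.
have bn i : (n <= i)%N -> b i = 0 by move=> ni; rewrite /b ltnNge ni.
have bz i : c i = 0 -> b i = 0.
  move=> ci; rewrite /b wz // mul0r; case: ifP => // _.
  by rewrite powR0 // gt_eqF // invr_gt0.
have bsupp v : finsupp n (fun i => of_real k (b i) * v i : K).
  by move=> i ni; rewrite bn // of_real0 mul0r.
have Fb v : carrier F (fun i => of_real k (b i) * v i : K).
  by apply: (carrier_finsupp hF (n := n)); exact: bsupp.
exists b; split=> // [v L vL|].
  have L0 := lnorm_le_ge0 vL.
  pose z i : K := of_real k (b i) * v i.
  have zz i : c i = 0 -> z i = 0 by move=> ci; rewrite /z bz // of_real0 mul0r.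
  have trz : trunc n z = z.
    by apply/funext => i; rewrite /trunc; case: ltnP => // ni; rewrite /z bsupp.
  have := Hw z zz; rewrite trz.
  have sum_le : \sum_(i < n) c i * (modulus (z i) `^ r / w i) <= L `^ r / G.
    apply: (@le_trans _ _ (\sum_(i < n) modulus (v i) `^ r / G)); last first.
      by rewrite -mulr_suml ler_pM2r ?invr_gt0 // -fin_lnorm_leP.
    apply: ler_sum => i _; have [ci|ci] := eqVneq (c i) 0.
      by rewrite ci mul0r divr_ge0 ?powR_ge0 // ltW.
    have ci0 : 0 < c i by rewrite lt0r ci c0.
    have wi := wc _ ci0.
    have frac0 : 0 <= w i / (G * c i) by rewrite divr_ge0 ?mulr_ge0 ?(ltW G0) ?(ltW wi).
    rewrite /z modulusM modulus_of_real ger0_norm // powRM ?modulus_ge0 //.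
    rewrite /b ltn_ord powR_invK // le_eqVlt; apply/orP; left; apply/eqP.
    have cancel_weight (u g d V : R) : 0 < u -> 0 < g -> 0 < d ->
        d * (u / (g * d) * V / u) = V / g.
      by move=> u0 g0 d0; field; rewrite !gt_eqF.
    exact: cancel_weight.
  move=> H; apply: (le_powR_pow2 r1) => //; first exact: (sym_norm_ge0 hF).
  have : seq_norm F z `^ r / G <= 2 * (L `^ r / G).
    by apply: le_trans H _; apply: ler_wpM2l.
  by rewrite mulrA ler_pM2r // invr_gt0.
have Gle : G `^ r^-1 <= C * seq_norm F (root_seq (k := k) n r w).
  have := envelope_le hF r1 HC C0 (fun i (_ : (i < n)%N) => w0 i).
  have CN0 : 0 <= C * seq_norm F (root_seq (k := k) n r w).
    by rewrite mulr_ge0 ?(ltW C0) // (sym_norm_ge0 hF) //; exact: carrier_trunc.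
  by move=> H; rewrite -(ler_powR_pos r0) ?powR_ge0 // (powR_invK r0 (ltW G0)).
pose t := Y / G `^ r^-1.
have t0 : 0 <= t by rewrite divr_ge0 ?powR_ge0 // ltW.
have Fg : carrier F (root_seq (k := k) n r w) by exact: carrier_trunc.
have -> : seq_norm F (fun i => of_real k (b i) * y i) =
    t * seq_norm F (root_seq (k := k) n r w).
  have -> : t = modulus (of_real k t) by rewrite modulus_of_real ger0_norm.
  rewrite -(sym_norm_scale hF _ Fg); apply: (sym_norm_modulus hF) => //.
    exact: sym_scale.
  move=> i; rewrite !modulusM !modulus_of_real !ger0_norm //.
  rewrite /root_seq /trunc /b; case: ifP => ilt; last by rewrite modulus0 !(mul0r,mulr0).
  rewrite modulus_of_real (ger0_norm (powR_ge0 _ _)).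
  have [ci|ci] := eqVneq (c i) 0.
    by rewrite wz // mul0r powR0 ?gt_eqF ?invr_gt0 // mulr0 mul0r.
  have ci0 : 0 < c i by rewrite lt0r ci c0.
  have cE : (c i) `^ r^-1 = modulus (y i) / Y.
    by rewrite powRK_inv // divr_ge0 ?modulus_ge0 // ltW.
  have yi : 0 < modulus (y i).
    rewrite lt0r modulus_ge0 andbT modulus_eq0 -(lnorm_weight_eq0 r1 Y0) //.
  rewrite powR_div ?mulr_ge0 ?(ltW G0) // powRM ?(ltW G0) // cE /t.
  have cancel_weight (u g d V : R) : 0 < g -> 0 < d -> 0 < V ->
      u / (g * (V / d)) * V = d / g * u.
    by move=> g0 d0 V0; field; rewrite !gt_eqF.
  by apply: cancel_weight => //; exact: powR_gt0.
have -> : C * (t * seq_norm F (root_seq (k := k) n r w)) =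
  t * (C * seq_norm F (root_seq (k := k) n r w)) by rewrite mulrCA.
apply: le_trans (ler_wpM2l t0 Gle).
by rewrite /t divfK // gt_eqF // powR_gt0.
Qed.

(** The norm of l_q is recovered, up to constants, from [F] by multipliers.
    For [q] infinite, selecting the largest coordinate suffices. *)
Lemma q_concave_factorization (F : seq_space R k) (q : \bar R) :
  (1 <= q)%E -> symmetric_seq_space F -> q_concave q F ->
  exists2 C : R, 0 < C & forall n (y : nat -> K),
  exists b : nat -> R,
  [/\ forall i, 0 <= b i, forall i, (n <= i)%N -> b i = 0,
      forall v L, lnorm_le q (fun i => modulus (v i)) L ->
        seq_norm F (fun i => of_real k (b i) * v i) <= C * L &
      fin_lnorm q (fun i : 'I_n => modulus (y i)) <=
        C * seq_norm F (fun i => of_real k (b i) * y i)].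
Proof.
(* [2] is for the multiplier [b] and [C] for the lower bound on [b * y]. *)
move=> q1 hF [C C0 HC]; exists (C + 2); first by rewrite addr_gt0.
have C1 : 1 <= C + 2 by lra.
move=> n y; set Y := fin_lnorm _ _.
have zeroE v : (fun i => of_real k (0 : R) * v i) = (fun=> 0 : K).
  by apply/funext => i; rewrite of_real0 mul0r.
have [Y0|Y0] := eqVneq Y 0.
  exists (fun=> 0); split=> //.
    move=> v L /lnorm_le_ge0 L0.
    by rewrite zeroE sym_norm0 // mulr_ge0 // (le_trans ler01).
  by rewrite Y0 zeroE sym_norm0 // mulr0.
have Y_gt0 : 0 < Y by rewrite lt0r Y0 fin_lnorm_ge0.
case/exponentP: q1 HC @Y Y0 Y_gt0 => [r r1|] HC Y Y0 Y_gt0.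
  have [b [b0 bn bM bY]] := q_concave_factorization_finite r1 hF C0 HC Y_gt0.
  exists b; split=> // [v L vL|].
    apply: le_trans (bM v L vL) _.
    by rewrite ler_wpM2r ?(lnorm_le_ge0 vL) // lerDr ltW.
  apply: le_trans bY _; rewrite ler_wpM2r ?lerDl //; apply: (sym_norm_ge0 hF).
  apply: (carrier_finsupp hF (n := n)) => i ni.
  by rewrite bn // of_real0 mul0r.
have [j Yj] : exists j : 'I_n, Y <= modulus (y j).
  apply/existsP; move: (ltxx Y); apply: contraFT => /existsPn H.
  apply: bigmax_lt => // j _; by rewrite ltNge H.
have [Fj Nj] := carrier_unit_seq hF j.
pose b (i : nat) : R := (i == j :> nat)%:R.
have bE v : seq_norm F (fun i => of_real k (b i) * v i) = modulus (v j).
  rewrite -[RHS]mulr1 -Nj -(sym_norm_scale hF _ Fj); apply: sym_norm_ext => i.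
  rewrite /b /unit_seq; have [->|_] := eqVneq i (j : nat).
    by rewrite of_real1 mul1r mulr1.
  by rewrite of_real0 mul0r mulr0.
exists b; split=> //.
- by move=> i ni; rewrite /b gtn_eqF // (leq_trans (ltn_ord j)).
- move=> v L vL; have L0 := lnorm_le_ge0 vL; rewrite bE.
  apply: (@le_trans _ _ L); last by rewrite ler_peMl.
  apply: le_trans (vL n).
  exact: (@ler_coord_fin_lnorm _ +oo%E n (fun i => modulus (v i)) j (leey _)
    (fun i => modulus_ge0 (v i))).
- rewrite bE; apply: le_trans Yj _; by rewrite ler_peMl ?modulus_ge0.
Qed.

End ConcaveFactorization.

(** * Superposition of multipliers *)

Section Superposition.
Context {R : realType}.

Definition dyadic (m : nat) : R := 2^-1 ^+ m.+1.

Lemma dyadic_gt0 m : 0 < dyadic m.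
Proof. by rewrite exprn_gt0 // invr_gt0. Qed.

Lemma dyadic_sum m : \sum_(i < m) dyadic i = 1 - 2^-1 ^+ m.
Proof.
elim: m => [|m IH]; first by rewrite big_ord0 expr0 subrr.
by rewrite big_ord_recr /= IH /dyadic exprS; lra.
Qed.

Lemma dyadic_sum_le1 m : \sum_(i < m) dyadic i <= 1.
Proof. by rewrite dyadic_sum gerBl exprn_ge0 // invr_ge0. Qed.

Lemma dyadic_series_cvg (f : nat -> R) (B : R) : (forall m, 0 <= f m <= B) ->
  exists2 l, (fun n => \sum_(m < n) dyadic m * f m) @ \oo --> l &
    forall m, dyadic m * f m <= l.
Proof.
move=> fB.
have term0 m : 0 <= dyadic m * f m.
  by case/andP: (fB m) => f0 _; rewrite mulr_ge0 // ltW // dyadic_gt0.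
have nd : nondecreasing_seq (fun n => \sum_(m < n) dyadic m * f m).
  apply/nondecreasing_seqP => n; by rewrite big_ord_recr lerDl.
have cv : cvgn (fun n => \sum_(m < n) dyadic m * f m).
  apply: nondecreasing_is_cvgn => //; exists B => _ [n _ <-].
  have B0 : 0 <= B by case/andP: (fB 0%N); exact: le_trans.
  apply: (@le_trans _ _ (\sum_(m < n) dyadic m * B)).
    apply: ler_sum => m _; case/andP: (fB m) => _ fm.
    by rewrite ler_wpM2l // ltW // dyadic_gt0.
  by rewrite -mulr_suml ler_piMl // dyadic_sum_le1.
exists (lim ((fun n => \sum_(m < n) dyadic m * f m) @ \oo)) => // m.
have := nondecreasing_cvgn_le nd cv m.+1; apply: le_trans.
by rewrite big_ord_recr /= lerDr sumr_ge0.
Qed.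

End Superposition.

Section Multipliers.
Context {R : realType} {k : scalar_kind}.
Local Notation K := (scalars R k).

Lemma lnorm_le_unit_seq (q : \bar R) i : (1 <= q)%E ->
  lnorm_le q (fun j => modulus (unit_seq (k := k) i j : K)) 1.
Proof.
move=> /exponentP[r r1|] n; last first.
  apply: bigmax_le => // j _; rewrite /unit_seq; case: eqP => _.
    by rewrite modulus1.
  by rewrite modulus0.
have r0 : 0 < r := lt_le_trans ltr01 r1.
rewrite fin_lnorm_leP // powR1.
have termE (j : nat) : modulus (unit_seq (k := k) i j : K) `^ r = (j == i)%:R.
  rewrite /unit_seq; case: eqP => _; first by rewrite modulus1 powR1.
  by rewrite modulus0 powR0 // gt_eqF.
under eq_bigr do rewrite termE.
have [ni|ilt] := leqP n i.
  by rewrite big1 // => j _; rewrite ltn_eqF // (leq_trans (ltn_ord j)).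
rewrite (bigD1 (Ordinal ilt)) //= eqxx big1 ?addr0 // => j.
by rewrite -val_eqE /= => /negbTE ->.
Qed.

(** The superposition is [\sum_m dyadic m * a_ m]: Minkowski's inequality bounds
    its partial sums as multipliers, and balls of l_p are closed under
    coordinatewise limits. *)
Lemma superpose_into_lp (p : \bar R) (E : seq_space R k) (C : R)
    (a_ : nat -> nat -> R) :
  (1 <= p)%E -> symmetric_seq_space E -> (forall m i, 0 <= a_ m i) ->
  (forall m z, carrier E z ->
    lnorm_le p (fun i => a_ m i * modulus (z i)) (C * seq_norm E z)) ->
  exists a : nat -> R, [/\ forall i, 0 <= a i,
    forall m i, dyadic m * a_ m i <= a i &
    forall z, carrier E z ->
      lnorm_le p (fun i => a i * modulus (z i)) (C * seq_norm E z)].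
Proof.
move=> p1 hE a0 aM.
have a_le m i : 0 <= a_ m i <= C.
  rewrite a0 /=; have [Ei Ni] := carrier_unit_seq hE i.
  have az0 (j : 'I_i.+1) : 0 <= a_ m j * modulus (unit_seq (k := k) i j : K).
    by rewrite mulr_ge0 ?modulus_ge0.
  have := aM m _ Ei i.+1; rewrite Ni mulr1; apply: le_trans.
  have := @ler_coord_fin_lnorm _ p i.+1 _ ord_max p1 az0.
  by rewrite /unit_seq /= eqxx modulus1 mulr1.
have /choice [a aP] : forall i, exists l,
    (fun n => \sum_(m < n) dyadic m * a_ m i) @ \oo --> l /\
    forall m, dyadic m * a_ m i <= l.
  by move=> i; have [l] := dyadic_series_cvg (fun m => a_le m i); exists l.
have age0 i : 0 <= a i.
  by apply: le_trans ((aP i).2 0%N); rewrite mulr_ge0 // ltW // dyadic_gt0.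
exists a; split=> // [m i|z Ez n]; first exact: (aP i).2.
have z0 := sym_norm_ge0 hE Ez.
have part0 N j : 0 <= \sum_(m < N) dyadic m * a_ m j.
  by apply: sumr_ge0 => m _; rewrite mulr_ge0 // ltW // dyadic_gt0.
have C0 : 0 <= C by case/andP: (a_le 0%N 0%N); exact: le_trans.
have partial_le N : lnorm_le p
    (fun j => (\sum_(m < N) dyadic m * a_ m j) * modulus (z j))
    ((\sum_(m < N) dyadic m) * (C * seq_norm E z)).
  elim: N => [|N IH].
    move=> N; rewrite big_ord0 mul0r.
    under eq_fin_lnorm do rewrite big_ord0.
    by rewrite fin_lnormZ // => [|j]; rewrite ?mul0r // modulus_ge0.
  rewrite big_ord_recr mulrDl /=.
  have H := lnorm_leD p1 _ _ IH (lnorm_leZ p1 (ltW (dyadic_gt0 N)) _ (aM N z Ez)).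
  move=> l; have := H _ _ _ l; under eq_fin_lnorm do rewrite mulrA -mulrDl.
  move=> {}H; under eq_fin_lnorm do rewrite big_ord_recr /=.
  by apply: H => j; rewrite !mulr_ge0 ?modulus_ge0 // ltW // dyadic_gt0.
apply: (@fin_lnorm_lim _ p n
   (fun N j => (\sum_(m < N) dyadic m * a_ m j) * modulus (z j))) => //.
- by move=> N j; rewrite mulr_ge0 ?modulus_ge0.
- by move=> j; rewrite mulr_ge0 ?modulus_ge0.
- by move=> j; apply: cvgMl; exact: (aP j).1.
- move=> N; apply: le_trans (partial_le N n) _.
  by rewrite ler_piMl ?dyadic_sum_le1 // mulr_ge0.
Qed.

(** The same superposition for multipliers from l_q to [F]. Norms in [F] need
    not be lower semicontinuous under coordinatewise limits, so completeness of
    [F] is what puts the limit in the space. *)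
Lemma superpose_from_lq (q : \bar R) (F : seq_space R k) (C : R)
    (n_ : nat -> nat) (b_ : nat -> nat -> R) :
  (1 <= q)%E -> symmetric_seq_space F -> (forall m i, 0 <= b_ m i) ->
  (forall m i, (n_ m <= i)%N -> b_ m i = 0) ->
  (forall m v L, lnorm_le q (fun i => modulus (v i)) L ->
    seq_norm F (fun i => of_real k (b_ m i) * v i) <= C * L) ->
  exists b : nat -> R, [/\ forall i, 0 <= b i,
    forall m i, dyadic m * b_ m i <= b i &
    forall v L, lnorm_le q (fun i => modulus (v i)) L ->
      carrier F (fun i => of_real k (b i) * v i) /\
      seq_norm F (fun i => of_real k (b i) * v i) <= C * L].
Proof.
move=> q1 hF b0 b_supp bM.
have Fb m v : carrier F (fun i => of_real k (b_ m i) * v i).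
  apply: (carrier_finsupp hF (n := n_ m)) => i ni.
  by rewrite b_supp // of_real0 mul0r.
have b_le m i : 0 <= b_ m i <= C.
  rewrite b0 /=; have := bM m _ _ (lnorm_le_unit_seq i q1); rewrite mulr1.
  apply: le_trans; apply: le_trans (ler_coord_sym_norm hF i (Fb _ _)).
  by rewrite modulusM modulus_of_real /unit_seq eqxx modulus1 mulr1 ger0_norm.
have C0 : 0 <= C by case/andP: (b_le 0%N 0%N); exact: le_trans.
have /choice [b bP] : forall i, exists l,
    (fun n => \sum_(m < n) dyadic m * b_ m i) @ \oo --> l /\
    forall m, dyadic m * b_ m i <= l.
  by move=> i; have [l] := dyadic_series_cvg (fun m => b_le m i); exists l.
have bge0 i : 0 <= b i.
  by apply: le_trans ((bP i).2 0%N); rewrite mulr_ge0 // ltW // dyadic_gt0.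
exists b; split=> // [m i|v L vL]; first exact: (bP i).2.
have L0 := lnorm_le_ge0 vL; have CL0 : 0 <= C * L by rewrite mulr_ge0.
pose f m i : K := of_real k (dyadic m) * (of_real k (b_ m i) * v i).
have Ff m : carrier F (f m) by exact: (sym_scale hF).
have Nf m : seq_norm F (f m) <= dyadic m * (C * L).
  rewrite /f (sym_norm_scale hF _ (Fb m v)) modulus_of_real.
  by rewrite gtr0_norm ?dyadic_gt0 // ler_wpM2l ?bM // ltW // dyadic_gt0.
pose u N i : K := \sum_(m <- index_iota 0 N) f m i.
have Fu N : carrier F (u N) := (carrier_sum hF _ Ff).1.
have uE N i : u N i = of_real k (\sum_(m < N) dyadic m * b_ m i) * v i.
  rewrite /u big_mkord; elim: N => [|N IH]; first by rewrite !big_ord0 of_real0 mul0r.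
  by rewrite !big_ord_recr /= IH of_realD mulrDl of_realM /f mulrA.
have sum_dyadic m m' : (m <= m')%N ->
    \sum_(i <- index_iota m m') dyadic i <= 2^-1 ^+ m :> R.
  move=> mm'; have := dyadic_sum (R := R) m'.
  rewrite -(big_mkord xpredT dyadic) (big_cat_nat (n := m)) //=.
  rewrite [X in X + _](big_mkord xpredT dyadic) dyadic_sum => H.
  have : 0 <= 2^-1 ^+ m' :> R by rewrite exprn_ge0 // invr_ge0.
  by move: H; lra.
have Nu m m' : (m <= m')%N ->
    seq_norm F (fun i => u m' i - u m i) <= 2^-1 ^+ m * (C * L).
  move=> mm'; have [_] := carrier_sum hF (index_iota m m') Ff.
  have -> : (fun i => \sum_(j <- index_iota m m') f j i) = (fun i => u m' i - u m i).
    apply/funext => i; apply/esym/eqP; rewrite subr_eq addrC; apply/eqP.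
    by rewrite {1}/u (big_cat_nat (n := m)).
  move/le_trans; apply.
  apply: (@le_trans _ _ (\sum_(i <- index_iota m m') dyadic i * (C * L))).
    exact: ler_sum.
  by rewrite -mulr_suml ler_wpM2r // sum_dyadic.
have Fsub := carrier_sub hF; have Nsub := sym_norm_subC hF.
have small (e : R) : 0 < e -> exists N, 2^-1 ^+ N * (C * L) < e.
  move=> e0; have h : `|2^-1 : R| < 1 by rewrite gtr0_norm ?invr_gt0 // invf_lt1 // ltr1n.
  have e1 : 0 < e / (C * L + 1) by rewrite divr_gt0 // ltr_wpDl.
  have /cvgrPdist_lt /(_ _ e1) [N _ /(_ N (leqnn N))] := cvg_expr h.
  rewrite sub0r normrN ger0_norm ?exprn_ge0 ?invr_ge0 // ltr_pdivlMr ?ltr_wpDl // => H.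
  by exists N; apply: le_lt_trans H; rewrite ler_wpM2l ?lerDl.
have cauchy (e : R) : 0 < e -> exists N, forall m m', (N <= m)%N -> (N <= m')%N ->
    seq_norm F (fun i => u m i - u m' i) < e.
  move=> /small [N HN]; exists N => m m'.
  wlog mm' : m m' / (m <= m')%N => [H|] Nm Nm'.
    case/orP: (leq_total m m') => ?; first exact: H.
    by rewrite Nsub //; exact: H.
  rewrite Nsub //; apply: le_lt_trans (Nu _ _ mm') _; apply: le_lt_trans HN.
  by rewrite ler_wpM2r // ler_wiXn2l ?invr_ge0 // invf_le1 // ler1n.
have [y Fy uy] := sym_complete hF Fu cauchy.
have yE : y = (fun i => of_real k (b i) * v i).
  apply/funext => i; apply: (@cvg_modulus_uniq _ _ (fun N => u N i)).
    apply/cvg_modulusP => e e0; move/cvgrPdist_lt: uy => /(_ _ e0).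
    apply: filterS => N; rewrite sub0r normrN; apply: le_lt_trans.
    apply: le_trans (ler_norm _); rewrite -modulusN opprB.
    exact: (ler_coord_sym_norm hF i (Fsub _ _ (Fu N) Fy)).
  apply/cvg_modulusP => e e0.
  have e1 : 0 < e / (modulus (v i) + 1) by rewrite divr_gt0 // ltr_wpDl ?modulus_ge0.
  move/cvgrPdist_lt: (bP i).1 => /(_ _ e1); apply: filterS => N.
  rewrite ltr_pdivlMr ?ltr_wpDl ?modulus_ge0 //; apply: le_lt_trans.
  have -> : of_real k (b i) * v i - u N i =
      of_real k (b i - \sum_(m < N) dyadic m * b_ m i) * v i.
    by apply/eqP; rewrite subr_eq uE -mulrDl -of_realD subrK.
  by rewrite modulusM modulus_of_real ler_wpM2l ?lerDl.
rewrite -yE; split=> //; apply/ler_addgt0Pr => e e0.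
move/cvgrPdist_lt: uy => /(_ _ e0) [N _ /(_ N (leqnn N))].
rewrite sub0r normrN => /(le_lt_trans (ler_norm _)) uy_lt.
have -> : seq_norm F y = seq_norm F (fun i => u N i + (y i - u N i)).
  by apply: sym_norm_ext => i; rewrite addrC subrK.
apply: le_trans (sym_norm_triangle hF (Fu N) (Fsub _ _ Fy (Fu N))) _.
rewrite lerD //; last by rewrite Nsub // ltW.
have [_ H] := carrier_sum hF (index_iota 0 N) Ff; apply: le_trans H _.
apply: (@le_trans _ _ (\sum_(i <- index_iota 0 N) dyadic i * (C * L))).
  exact: ler_sum.
by rewrite -mulr_suml ler_piMl // big_mkord dyadic_sum_le1.
Qed.

End Multipliers.

(** * Boundedness of the Schur product *)

Section UniformBound.
Context {R : realType} {k : scalar_kind}.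
Local Notation K := (scalars R k).
Local Notation lnorm_of p n u := (fin_lnorm p (fun i : 'I_n => modulus (u i))).

(** Multiplying the coordinates of [x] by suitable phases turns the bound on
    sections into absolute convergence of each row series, uniformly
    in [p]; a coordinatewise limit then bounds the image of [x]. *)
Lemma bounded_matrices_of_sections (p q : \bar R) (T : inf_matrix R k) (L : R) :
  (1 <= p)%E -> (1 <= q)%E -> 0 <= L ->
  (forall J n (x : nat -> K),
    lnorm_of q n (fun i => \sum_(j < J) T i j * x j) <= L * lnorm_of p J x) ->
  bounded_matrices (lp p) (lp q) T.
Proof.
move=> p1 q1 L0 HT; exists L => x lpx.
have xN := carrier_lp_le p1 lpx; set N := seq_norm (lp p) x in xN *.
have row i J : \sum_(j < J) modulus (T i j * x j) <= L * N.
  have /choice [ph phP] : forall j, exists z : K,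
      modulus z = 1 /\ T i j * x j = z * of_real k (modulus (T i j * x j)).
    by move=> j; have [z] := phase_decomposition (T i j * x j); exists z.
  pose x' j : K := (ph j)^-1 * x j.
  have ph0 j : ph j != 0 by rewrite -modulus_eq0 (phP j).1 oner_eq0.
  have phV j : modulus (ph j)^-1 = 1.
    by have := modulusM (ph j) (ph j)^-1; rewrite divff // modulus1 (phP j).1 mul1r.
  have Tx' j : T i j * x' j = of_real k (modulus (T i j * x j)).
    by rewrite /x' mulrCA [in LHS](phP j).2 mulKf.
  have sumE : \sum_(j < J) T i j * x' j =
      of_real k (\sum_(j < J) modulus (T i j * x j)).
    elim: J => [|J IH]; first by rewrite !big_ord0 of_real0.
    by rewrite !big_ord_recr /= IH of_realD Tx'.
  have sum0 : 0 <= \sum_(j < J) modulus (T i j * x j).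
    by apply: sumr_ge0 => j _; exact: modulus_ge0.
  have -> : \sum_(j < J) modulus (T i j * x j) = modulus (\sum_(j < J) T i j * x' j).
    by rewrite sumE modulus_of_real ger0_norm.
  have := @ler_coord_fin_lnorm _ q i.+1
    (fun l => modulus (\sum_(j < J) T l j * x' j)) ord_max q1
    (fun l => modulus_ge0 _).
  move/le_trans; apply; apply: le_trans (HT J i.+1 x') _.
  rewrite ler_wpM2l //; apply: le_trans (xN J).
  rewrite le_eqVlt; apply/orP; left; apply/eqP; apply: eq_fin_lnorm => j.
  by rewrite /x' modulusM phV mul1r.
have /choice [y yP] : forall i, exists l : K, series (fun j => T i j * x j) @ \oo --> l.
  by move=> i; exact: abs_bounded_series_cvg (row i).
have yle : lnorm_le q (fun i => modulus (y i)) (L * N).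
  move=> n; apply: (@fin_lnorm_lim _ q n
    (fun J i => modulus (\sum_(j < J) T i j * x j))) => //.
  - by move=> *; exact: modulus_ge0.
  - by move=> *; exact: modulus_ge0.
  - move=> i; apply/cvgrPdist_lt => e e0.
    move/cvg_modulusP: (yP i) => /(_ _ e0); apply: filterS => J.
    rewrite /series /= big_mkord; apply: le_lt_trans.
    set s := \sum_(j < J) _; rewrite ler_norml; apply/andP; split.
      have := ler_modulusD (s - y i) (y i).
      by rewrite subrK -[modulus (s - _)]modulusN opprB; lra.
    by have := ler_modulusD (y i - s) s; rewrite subrK; lra.
  - move=> J; apply: le_trans (HT J n x) _.
    by rewrite ler_wpM2l.
by have [ly Ny] := carrier_lp q1 yle; exists y.
Qed.

Lemma sandwich_bounded (p q : \bar R) (E F : seq_space R k) (A : inf_matrix R k)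
    (a b : nat -> R) (C D : R) :
  (1 <= p)%E -> (1 <= q)%E -> 0 <= D -> (forall i, 0 <= a i) ->
  bounded_matrices (lp p) (lp q) A ->
  (forall z, carrier E z ->
    lnorm_le p (fun i => a i * modulus (z i)) (C * seq_norm E z)) ->
  (forall v L, lnorm_le q (fun i => modulus (v i)) L ->
    carrier F (fun i => of_real k (b i) * v i) /\
    seq_norm F (fun i => of_real k (b i) * v i) <= D * L) ->
  bounded_matrices E F (fun i j => of_real k (b i) * A i j * of_real k (a j)).
Proof.
move=> p1 q1 D0 a0 [CA HA] aM bM.
exists (D * (`|CA| * C)) => z Ez.
pose az i : K := of_real k (a i) * z i.
have az_le : lnorm_le p (fun i => modulus (az i)) (C * seq_norm E z).
  move=> n; apply: le_trans (aM z Ez n).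
  rewrite le_eqVlt; apply/orP; left; apply/eqP; apply: eq_fin_lnorm => j.
  by rewrite modulusM modulus_of_real ger0_norm.
have [lpaz Naz] := carrier_lp p1 az_le.
have [y [lqy sy Ny]] := HA _ lpaz.
have [Fby Nby] := bM _ _ (carrier_lp_le q1 lqy).
exists (fun i => of_real k (b i) * y i); split=> //.
  move=> i; have -> : series (fun j => of_real k (b i) * A i j * of_real k (a j) * z j) =
      (fun n => of_real k (b i) * series (fun j => A i j * az j) n).
    apply/funext => n; rewrite /series /= mulr_sumr.
    by apply: eq_bigr => j _; rewrite /az !mulrA.
  by apply: (@cvgM K); [exact: cvg_cst | exact: sy].
apply: le_trans Nby _; rewrite -mulrA; apply: ler_wpM2l => //.
apply: le_trans Ny _; rewrite -mulrA.
have Naz0 : 0 <= seq_norm (lp p) az.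
  exact: le_trans (fin_lnorm_ge0 p (fun i : 'I_0 => modulus (az i))) (carrier_lp_le p1 lpaz 0%N).
apply: (@le_trans _ _ (`|CA| * seq_norm (lp p) az)).
  by rewrite ler_wpM2r // ler_norm.
by rewrite ler_wpM2l.
Qed.

Variables (p q : \bar R) (E F : seq_space R k).
Hypotheses (p1 : (1 <= p)%E) (q1 : (1 <= q)%E).
Hypotheses (hE : symmetric_seq_space E) (hF : symmetric_seq_space F).
Hypotheses (convE : p_convex p E) (concF : q_concave q F).

(** If the sections of [M * A] were unbounded, the factors attached to
    a sequence of bad vectors could be superposed into one pair [a], [b] with
    [dyadic m * a_ m <= a] and [dyadic m * b_ m <= b]. Since [M] is a
    multiplier of [B(E, F)], the matrix [b * (M * A) * a] is bounded with some constant, and by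
    solidity this bounds the [m]-th bad vector with a loss of at most
    [dyadic m ^- 2]. *)
Lemma multiplier_sections_bounded (M A : inf_matrix R k) :
  schur_multipliers E F M -> bounded_matrices (lp p) (lp q) A ->
  exists2 L : R, 0 <= L & forall J n (x : nat -> K),
    lnorm_of q n (fun i => \sum_(j < J) schur_product M A i j * x j) <=
    L * lnorm_of p J x.
Proof.
move=> HM HA; have [C C0 fE] := p_convex_factorization p1 hE convE.
have [D D0 fF] := q_concave_factorization q1 hF concF.
apply: contrapT => unbounded.
pose T := schur_product M A.
(* The factor [dyadic m ^- 2] anticipates the two losses of a factor
   [dyadic m], one for [a] and one for [b]. *)
have /choice [bad badP] : forall m, exists t : nat * nat * (nat -> K),
    m%:R / dyadic m ^+ 2 * lnorm_of p t.1.1 t.2 <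
    lnorm_of q t.1.2 (fun i => \sum_(j < t.1.1) T i j * t.2 j).
  move=> m; apply: contrapT => good; apply: unbounded.
  exists (m%:R / dyadic m ^+ 2).
    by rewrite divr_ge0 // exprn_ge0 // ltW // dyadic_gt0.
  move=> J n x; rewrite leNgt; apply/negP => H; apply: good.
  by exists (J, n, x).
pose J m := (bad m).1.1; pose n m := (bad m).1.2; pose x m := (bad m).2.
pose y m i := \sum_(j < J m) T i j * x m j.
have {badP} badP m : m%:R / dyadic m ^+ 2 * lnorm_of p (J m) (x m) <
  lnorm_of q (n m) (y m) := badP m.
have /choice [ae aeP] : forall m, exists t : (nat -> R) * (nat -> K),
  [/\ forall i, 0 <= t.1 i, finsupp (J m) t.2,
      forall i, (i < J m)%N -> x m i = of_real k (t.1 i) * t.2 i,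
      seq_norm E t.2 <= C * lnorm_of p (J m) (x m) &
      forall z, carrier E z ->
        lnorm_le p (fun i => t.1 i * modulus (z i)) (C * seq_norm E z)].
  by move=> m; have [a [e H]] := fE (J m) (x m); exists (a, e).
have /choice [b_ bP] := fun m => fF (n m) (y m).
have [a [a0 a_le aM]] := superpose_into_lp p1 hE
  (fun m => let: And5 h _ _ _ _ := aeP m in h)
  (fun m => let: And5 _ _ _ _ h := aeP m in h).
have [b [b0 b_le bM]] := superpose_from_lq q1 hF
  (fun m => let: And4 h _ _ _ := bP m in h)
  (fun m => let: And4 _ h _ _ := bP m in h)
  (fun m => let: And4 _ _ h _ := bP m in h).
have [L0 HL] := HM _ (sandwich_bounded p1 q1 (ltW D0) a0 HA aM bM).
have [m m_gt] : exists m : nat, D * (`|L0| * C) < m%:R.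
  exists (Num.bound (D * (`|L0| * C))); apply: archi_boundP.
  by rewrite mulr_ge0 ?(ltW D0) // mulr_ge0 ?(ltW C0).
have [am0 esupp xE Ne _] := aeP m; have [bm0 bsupp _ y_le] := bP m.
set a_m := (ae m).1 in am0 xE; set e := (ae m).2 in esupp xE Ne.
have d0 : 0 < dyadic m :> R := dyadic_gt0 m.
(* Since [a] dominates [dyadic m * a_m], this vector is dominated by [e],
   and [a * z] is the [m]-th bad vector up to the factor [dyadic m]. *)
pose z i : K := of_real k (dyadic m * a_m i / a i) * e i.
have Ee : carrier E e by exact: (carrier_finsupp hE esupp).
have zsupp : finsupp (J m) z by move=> i Ji; rewrite /z esupp // mulr0.
have Ez : carrier E z by exact: (carrier_finsupp hE zsupp).
have az i : (i < J m)%N -> of_real k (a i) * z i = of_real k (dyadic m) * x m i.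
  move=> iJ; rewrite xE // /z !mulrA -!of_realM; congr (of_real k _ * _).
  have [ai|ai] := eqVneq (a i) 0; last by rewrite mulrC divfK.
  have := a_le m i; rewrite ai -/a_m => H; rewrite mul0r.
  by apply/eqP; rewrite eq_le H mulr_ge0 // ltW.
have Nz : seq_norm E z <= seq_norm E e.
  apply: (sym_mono hE) => // i; rewrite /z modulusM modulus_of_real.
  rewrite ler_piMl ?modulus_ge0 // ger0_norm; last first.
    by rewrite divr_ge0 // mulr_ge0 // ltW.
  have [ai|ai] := eqVneq (a i) 0; first by rewrite ai invr0 mulr0.
  by rewrite ler_pdivrMr ?lt0r ?ai ?a0 // mul1r; exact: a_le.
have [y' [Fy' sy' Ny']] := HL z Ez.
have y'E i : y' i = of_real k (b i * dyadic m) * y m i.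
  apply: (cvg_modulus_uniq (sy' i)); apply/cvg_modulusP => eps eps0.
  exists (J m) => // l /= Jl.
  have Bz j : (J m <= j)%N -> schur_product M
      (fun i j => of_real k (b i) * A i j * of_real k (a j)) i j * z j = 0.
    by move=> Jj; rewrite zsupp // mulr0.
  rewrite /series /= (sum_stationary Jl Bz).
  have -> : \sum_(j < J m) schur_product M
      (fun i j => of_real k (b i) * A i j * of_real k (a j)) i j * z j =
      of_real k (b i * dyadic m) * y m i.
    rewrite /y mulr_sumr; apply: eq_bigr => j _; rewrite /T /schur_product.
    transitivity (of_real k (b i) * (M i j * A i j) * (of_real k (a j) * z j)).
      by ring.
    by rewrite az // of_realM; ring.
  by rewrite subrr modulus0.
pose by_ i : K := of_real k (b_ m i) * y m i.
have Fby : carrier F by_.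
  apply: (carrier_finsupp hF (n := n m)) => i ni.
  by rewrite /by_ bsupp // of_real0 mul0r.
have Nby : dyadic m ^+ 2 * seq_norm F by_ <= seq_norm F y'.
  have d2 : 0 <= dyadic m ^+ 2 :> R by rewrite exprn_ge0 // ltW.
  rewrite -[X in X * _]ger0_norm // -(modulus_of_real (k := k)).
  rewrite -(sym_norm_scale hF _ Fby); apply: (sym_mono hF) => //.
    exact: (sym_scale hF).
  move=> i; rewrite y'E /by_ !modulusM !modulus_of_real mulrA.
  apply: ler_wpM2r; first exact: modulus_ge0.
  rewrite !ger0_norm ?mulr_ge0 ?(ltW d0) //.
  by rewrite expr2 -mulrA [leRHS]mulrC; apply: ler_wpM2l; rewrite ?(ltW d0).
have X0 : 0 <= lnorm_of p (J m) (x m) by exact: fin_lnorm_ge0.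
have Ez0 := sym_norm_ge0 hE Ez.
have chain : seq_norm F y' <= `|L0| * (C * lnorm_of p (J m) (x m)).
  apply: le_trans Ny' _; apply: (@le_trans _ _ (`|L0| * seq_norm E z)).
    by rewrite ler_wpM2r // ler_norm.
  by rewrite ler_wpM2l // (le_trans Nz).
have := lt_le_trans (badP m) y_le; rewrite ltNge => /negP; apply.
have d2 : 0 < dyadic m ^+ 2 :> R by rewrite exprn_gt0.
rewrite [leRHS]mulrAC ler_pdivlMr // -mulrA.
have Nby' : seq_norm F by_ * dyadic m ^+ 2 <= `|L0| * (C * lnorm_of p (J m) (x m)).
  by rewrite mulrC; apply: le_trans Nby chain.
apply: le_trans (ler_wpM2l (ltW D0) Nby') _.
rewrite !mulrA; apply: ler_wpM2r => //; rewrite -mulrA; exact: ltW.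
Qed.

End UniformBound.

Theorem theorem4p12 (R : realType) (k : scalar_kind) (p q : \bar R)
    (E F : seq_space R k) :
  (1 <= p)%E -> (1 <= q)%E ->
  symmetric_seq_space E -> symmetric_seq_space F ->
  p_convex p E -> q_concave q F ->
  schur_multipliers E F `<=` schur_multipliers (lp p) (lp q).
Proof.
move=> p1 q1 hE hF convE concF M HM A HA.
have [L L0 HL] := multiplier_sections_bounded p1 q1 hE hF convE concF HM HA.
exact: bounded_matrices_of_sections p1 q1 L0 HL.
Qed.
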